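(* Let $A$ be a commutative associative unital $\mathbb C$-algebra. For all $\varphi,\chi\in\mathcal F$, the following identity holds in $\mathbf U(\mathfrak{sl}_2\otimes A)$: $$x^+(\varphi)\,x^-(\chi)=\sum_{\substack{\psi_1,\psi_2,\phi_1,\phi_2\in\mathcal F\\ \psi_1+\psi_2\in\mathcal F(\chi)\\ \phi_1+\phi_2\in\mathcal F(\varphi)}}(-1)^{|\psi_1|+|\psi_2|}\,D^-(\phi_1,\psi_1,\chi-\psi_1-\psi_2)\,\mathbb D(\phi_2,\psi_2,\varphi-\phi_1-\phi_2).$$
   Context: $\mathfrak{sl}_2$ (over $\mathbb C$) has basis $\{x^-,h,x^+\}$ with $[x^+,x^-]=h$, $[h,x^\pm]=\pm2x^\pm$; $\mathfrak{sl}_2\otimes A$ has bracket $[z\otimes a,z'\otimes b]=[z,z']\otimes ab$; $\mathbf U(\cdot)$ is the universal enveloping algebra; $u^{(r)}=u^r/r!$. Multisets: $\mathcal F$ is the set of finitely supported functions $\chi:A\to\mathbb Z_{\ge0}$, with pointwise addition and order ($\psi\le\chi$ iff $\psi(a)\le\chi(a)$ for all $a$), $|\chi|=\sum_a\chi(a)$; $\chi_a$ is the characteristic function of $\{a\}$; $\mathcal F(\chi)=\{\psi\in\mathcal F:\psi\le\chi\}$. For $\psi\in\mathcal F$: $\pi(\psi)=\prod_a a^{\psi(a)}$, $\mathcal M(\psi)=|\psi|!/\prod_a\psi(a)!$, $x^\pm(\psi)=\prod_{a}(x^\pm\otimes a)^{(\psi(a))}$. $\delta$ is the Kronecker delta.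 $p:\mathcal F^2\to\mathbf U(\mathbb Ch\otimes A)$ is defined recursively by $p(0,0)=1$, $p(\varphi,\chi)=0$ if $|\varphi|\neq|\chi|$, and for $\varphi,\chi\ne0$ with $|\varphi|=|\chi|$, $$p(\varphi,\chi)=-\frac1{|\varphi|}\sum_{\psi_1\in\mathcal F(\varphi)\setminus\{0\},\ \psi_2\in\mathcal F(\chi)\setminus\{0\}}\mathcal M(\psi_1)\mathcal M(\psi_2)(h\otimes\pi(\psi_1)\pi(\psi_2))\,p(\varphi-\psi_1,\chi-\psi_2).$$ $D^\pm:\mathcal F^3\to\mathbf U(\mathfrak{sl}_2\otimes A)$ is defined recursively by $D^\pm(\psi_1,\psi_2,0)=\delta_{|\psi_1|+|\psi_2|,0}$, $D^\pm(\psi_1,\psi_2,\chi_b)=\delta_{|\psi_1|,|\psi_2|}\mathcal M(\psi_1)\mathcal M(\psi_2)(x^\pm\otimes b\,\pi(\psi_1)\pi(\psi_2))$ for $b\in A$, and for $|\psi_3|\ge2$ $$D^\pm(\psi_1,\psi_2,\psi_3)=\frac1{|\psi_3|}\sum_{\phi_1\in\mathcal F(\psi_1),\ \phi_2\in\mathcal F(\psi_2)}\ \sum_{b\in\operatorname{supp}\psi_3}D^\pm(\phi_1,\phi_2,\chi_b)\,D^\pm(\psi_1-\phi_1,\psi_2-\phi_2,\psi_3-\chi_b).$$ $\mathbb D:\mathcal F^3\to\mathbf U(\mathfrak{sl}_2\otimes A)$ is defined by $$\mathbb D(\psi_1,\psi_2,\psi_3)=\sum_{\phi_1\in\mathcal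 F(\psi_1),\ \phi_2\in\mathcal F(\psi_2)}p(\phi_1,\phi_2)\,D^+(\psi_1-\phi_1,\psi_2-\phi_2,\psi_3).$$ *)

(* Defs.v *)
From HB Require Import structures.
From mathcomp Require Import all_boot all_order all_algebra.
From mathcomp Require Import finmap multiset.
From mathcomp Require Import boolp classical_sets functions cardinality fsbigop.
From mathcomp Require Import reals complex ring.

Set Implicit Arguments.
Unset Strict Implicit.
Unset Printing Implicit Defensive.

Import Order.TTheory GRing.Theory Num.Theory.
Local Open Scope mset_scope.
Local Open Scope quotient_scope.
Local Open Scope classical_set_scope.
Local Open Scope ring_scope.

HB.mixin Record Lmodule_isLieAlgebra (K : fieldType) L of GRing.Lmodule K L := {
  lie : L -> L -> L;
  lie_linearl : forall k x y z, lie (k *: x + y) z = k *: lie x z + lie y z;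
  lie_linearr : forall k x y z, lie x (k *: y + z) = k *: lie x y + lie x z;
  liexx : forall x, lie x x = 0;
  lie_jacobi : forall x y z,
    lie x (lie y z) + lie y (lie z x) + lie z (lie x y) = 0
}.

#[short(type="lieAlgType")]
HB.structure Definition LieAlgebra (K : fieldType) :=
  {L of Lmodule_isLieAlgebra K L & GRing.Lmodule K L}.

(* The universal enveloping algebra of [L]: the unital associative [K]-algebra
   generated by the elements of [L], subject to the linear relations of [L] and
   to [x, y] = x y - y x.  It is the quotient of the formal expressions by the least congruence [ueq] that makes it an
   algebra and contains these relations; [enveloping_universal] below is its
   universal property. *)

Inductive uterm (K L : Type) : Type :=
| UScal of K
| UGen of L
| UAdd of uterm K L & uterm K L
| UMul of uterm K L & uterm K L.
Arguments UScal {K L}.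
Arguments UGen {K L}.

HB.instance Definition _ (K L : Type) := gen_eqMixin (uterm K L).
HB.instance Definition _ (K L : Type) := gen_choiceMixin (uterm K L).

Section Enveloping.
Context (K : fieldType) (L : lieAlgType K).
Implicit Types (k l : K) (x y : L) (s t u : uterm K L).

Inductive ueq : uterm K L -> uterm K L -> Prop :=
| ueq_refl t : ueq t t
| ueq_sym s t : ueq s t -> ueq t s
| ueq_trans s t u : ueq s t -> ueq t u -> ueq s u
| ueq_add s s' t t' : ueq s s' -> ueq t t' -> ueq (UAdd s t) (UAdd s' t')
| ueq_mul s s' t t' : ueq s s' -> ueq t t' -> ueq (UMul s t) (UMul s' t')
| ueq_addA s t u : ueq (UAdd s (UAdd t u)) (UAdd (UAdd s t) u)
| ueq_addC s t : ueq (UAdd s t) (UAdd t s)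
| ueq_add0 t : ueq (UAdd (UScal 0) t) t
| ueq_addN t : ueq (UAdd (UMul (UScal (-1)) t) t) (UScal 0)
| ueq_mulA s t u : ueq (UMul s (UMul t u)) (UMul (UMul s t) u)
| ueq_mul1 t : ueq (UMul (UScal 1) t) t
| ueq_mulDl s t u : ueq (UMul (UAdd s t) u) (UAdd (UMul s u) (UMul t u))
| ueq_mulDr s t u : ueq (UMul s (UAdd t u)) (UAdd (UMul s t) (UMul s u))
| ueq_scalC k t : ueq (UMul (UScal k) t) (UMul t (UScal k))
| ueq_scalD k l : ueq (UScal (k + l)) (UAdd (UScal k) (UScal l))
| ueq_scalM k l : ueq (UScal (k * l)) (UMul (UScal k) (UScal l))
| ueq_linear k x y :
    ueq (UGen (k *: x + y)) (UAdd (UMul (UScal k) (UGen x)) (UGen y))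
| ueq_lie x y :
    ueq (UGen (lie x y))
        (UAdd (UMul (UGen x) (UGen y))
              (UMul (UScal (-1)) (UMul (UGen y) (UGen x)))).

Definition ueqb s t := `[< ueq s t >].

Lemma ueqb_refl : reflexive ueqb.
Proof. by move=> t; apply/asboolP; exact: ueq_refl. Qed.

Lemma ueqb_sym : symmetric ueqb.
Proof. by move=> s t; apply/asboolP/asboolP; exact: ueq_sym. Qed.

Lemma ueqb_trans : transitive ueqb.
Proof. by move=> t s u /asboolP st /asboolP tu; apply/asboolP/(ueq_trans st tu). Qed.

Canonical ueqb_equiv := EquivRel ueqb ueqb_refl ueqb_sym ueqb_trans.

Definition enveloping : Type := {eq_quot ueqb}.

HB.instance Definition _ := Choice.on enveloping.
HB.instance Definition _ := EqQuotient.on enveloping.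

Local Notation U := enveloping.
Implicit Types (v w z : U).

Definition ucls t : U := \pi_U t.

Lemma uclsP s t : ueq s t -> ucls s = ucls t.
Proof. by move=> st; apply/eqP; rewrite /ucls eqmodE; apply/asboolP. Qed.

Lemma ucls_eq s t : ucls s = ucls t -> ueq s t.
Proof. by move/eqP; rewrite /ucls eqmodE => /asboolP. Qed.

Lemma ucls_ind (P : U -> Prop) : (forall t, P (ucls t)) -> forall v, P v.
Proof. by move=> Pt v; rewrite -[v]reprK; exact: Pt. Qed.

Lemma repr_ucls t : ueq (repr (ucls t)) t.
Proof. by apply: ucls_eq; rewrite /ucls reprK. Qed.

Definition uadd v w := ucls (UAdd (repr v) (repr w)).
Definition umul v w := ucls (UMul (repr v) (repr w)).
Definition uscal k := ucls (UScal k).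
Definition ugen x := ucls (UGen x).

Lemma uaddE s t : uadd (ucls s) (ucls t) = ucls (UAdd s t).
Proof. by apply/uclsP/ueq_add; exact: repr_ucls. Qed.

Lemma umulE s t : umul (ucls s) (ucls t) = ucls (UMul s t).
Proof. by apply/uclsP/ueq_mul; exact: repr_ucls. Qed.

Let uE := (umulE, uaddE).

Lemma uaddA : associative uadd.
Proof.
by elim/ucls_ind=> s; elim/ucls_ind=> t; elim/ucls_ind=> u; rewrite !uE;
  exact/uclsP/ueq_addA.
Qed.

Lemma uaddC : commutative uadd.
Proof.
by elim/ucls_ind=> s; elim/ucls_ind=> t; rewrite !uE; exact/uclsP/ueq_addC.
Qed.

Lemma uadd0 : left_id (uscal 0) uadd.
Proof. by elim/ucls_ind=> t; rewrite uE; exact/uclsP/ueq_add0. Qed.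

Lemma uaddN : left_inverse (uscal 0) (umul (uscal (-1))) uadd.
Proof.
by elim/ucls_ind=> t; rewrite (umulE (UScal _)) uaddE; exact/uclsP/ueq_addN.
Qed.

Lemma umulA : associative umul.
Proof.
by elim/ucls_ind=> s; elim/ucls_ind=> t; elim/ucls_ind=> u; rewrite !uE;
  exact/uclsP/ueq_mulA.
Qed.

Lemma uscalC k v : umul (uscal k) v = umul v (uscal k).
Proof. by elim/ucls_ind: v => t; rewrite !uE; exact/uclsP/ueq_scalC. Qed.

Lemma umul1 : left_id (uscal 1) umul.
Proof. by elim/ucls_ind=> t; rewrite uE; exact/uclsP/ueq_mul1. Qed.

Lemma umulr1 : right_id (uscal 1) umul.
Proof. by move=> v; rewrite -uscalC umul1. Qed.

Lemma umulDl : left_distributive umul uadd.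
Proof.
by elim/ucls_ind=> s; elim/ucls_ind=> t; elim/ucls_ind=> u; rewrite !uE;
  exact/uclsP/ueq_mulDl.
Qed.

Lemma umulDr : right_distributive umul uadd.
Proof.
by elim/ucls_ind=> s; elim/ucls_ind=> t; elim/ucls_ind=> u; rewrite !uE;
  exact/uclsP/ueq_mulDr.
Qed.

Lemma uscalD k l : uscal (k + l) = uadd (uscal k) (uscal l).
Proof. by rewrite !uE; exact/uclsP/ueq_scalD. Qed.

Lemma uscalM k l : uscal (k * l) = umul (uscal k) (uscal l).
Proof. by rewrite !uE; exact/uclsP/ueq_scalM. Qed.

Section Eval.
Context (B : algType K) (f : L -> B).
Hypothesis f_linear : forall k x y, f (k *: x + y) = k *: f x + f y.
Hypothesis f_lie : forall x y, f (lie x y) = f x * f y - f y * f x.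

Fixpoint ueval t : B :=
  match t with
  | UScal k => k%:A
  | UGen x => f x
  | UAdd s t => ueval s + ueval t
  | UMul s t => ueval s * ueval t
  end.

Lemma ueval_ueq s t : ueq s t -> ueval s = ueval t.
Proof.
elim=> //= {s t}.
- by move=> s t u _ -> _ ->.
- by move=> s s' t t' _ -> _ ->.
- by move=> s s' t t' _ -> _ ->.
- by move=> s t u; rewrite addrA.
- by move=> s t; rewrite addrC.
- by move=> t; rewrite scale0r add0r.
- by move=> t; rewrite mulr_algl scaleN1r addNr scale0r.
- by move=> s t u; rewrite mulrA.
- by move=> t; rewrite scale1r mul1r.
- by move=> s t u; rewrite mulrDl.
- by move=> s t u; rewrite mulrDr.
- by move=> k t; rewrite mulr_algl mulr_algr.
- by move=> k l; rewrite scalerDl.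
- by move=> k l; rewrite mulr_algl scalerA.
- by move=> k x y; rewrite mulr_algl f_linear.
- by move=> x y; rewrite mulr_algl scaleN1r f_lie.
Qed.

End Eval.

Lemma uoner_neq0 : uscal 1 != uscal 0.
Proof.
apply/eqP => /ucls_eq /(@ueval_ueq K^o (fun=> 0)) /=.
rewrite scale1r scale0r => e10; have /eqP := oner_neq0 K; apply; apply: e10.
  by move=> *; rewrite scaler0 addr0.
by move=> *; rewrite mulr0 subr0.
Qed.

HB.instance Definition _ := GRing.isZmodule.Build U uaddA uaddC uadd0 uaddN.
HB.instance Definition _ :=
  GRing.Zmodule_isNzRing.Build U umulA umul1 umulr1 umulDl umulDr uoner_neq0.

Definition uscale k v : U := uscal k * v.

Lemma uscaleA k l v : uscale k (uscale l v) = uscale (k * l) v.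
Proof. by rewrite /uscale uscalM mulrA. Qed.

Lemma uscale1 : left_id 1 uscale.
Proof. exact: umul1. Qed.

Lemma uscaleDr : right_distributive uscale +%R.
Proof. by move=> k v w; rewrite /uscale mulrDr. Qed.

Lemma uscaleDl v : {morph uscale^~ v : k l / k + l}.
Proof. by move=> k l; rewrite /uscale uscalD -mulrDl. Qed.

HB.instance Definition _ :=
  GRing.Zmodule_isLmodule.Build K U uscaleA uscale1 uscaleDr uscaleDl.

Lemma uscaleAl k v w : k *: (v * w) = k *: v * w.
Proof. exact: mulrA. Qed.

HB.instance Definition _ := GRing.Lmodule_isLalgebra.Build K U uscaleAl.

Lemma uscaleAr k v w : k *: (v * w) = v * (k *: w).
Proof.
have ck : uscal k * v = v * uscal k by exact: uscalC.
by rewrite -[LHS]/(uscal k * (v * w)) -[k *: w]/(uscal k * w) !mulrA ck.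
Qed.

HB.instance Definition _ := GRing.Lalgebra_isAlgebra.Build K U uscaleAr.

Lemma ugen_linear : linear ugen.
Proof.
move=> k x y; rewrite -[RHS]/(uadd (umul (uscal k) (ugen x)) (ugen y)).
by rewrite (umulE (UScal k)) uaddE; exact/uclsP/ueq_linear.
Qed.

HB.instance Definition _ := GRing.isLinear.Build K L U *:%R ugen ugen_linear.

Lemma ugen_lie x y : ugen (lie x y) = ugen x * ugen y - ugen y * ugen x.
Proof.
pose opp : U := umul (uscal (-1)) (umul (ugen y) (ugen x)).
rewrite -[RHS]/(uadd (umul (ugen x) (ugen y)) opp) /opp.
by rewrite (umulE (UGen y)) (umulE (UScal _)) umulE uaddE; exact/uclsP/ueq_lie.
Qed.

Lemma enveloping_universal (B : algType K) (f : {linear L -> B}) :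
  (forall x y, f (lie x y) = f x * f y - f y * f x) ->
  exists g : {lrmorphism U -> B}, (forall x, g (ugen x) = f x) /\
    forall g' : {lrmorphism U -> B}, (forall x, g' (ugen x) = f x) -> g' =1 g.
Proof.
move=> f_lie; have f_lin k x y : f (k *: x + y) = k *: f x + f y.
  by rewrite linearP.
pose g v := ueval f (repr v).
have gE t : g (ucls t) = ueval f t.
  by apply: (ueval_ueq f_lin f_lie); exact: repr_ucls.
have g_lin : linear g.
  move=> k; elim/ucls_ind=> s; elim/ucls_ind=> t.
  rewrite -[_ + _]/(uadd (umul (uscal k) (ucls s)) (ucls t)).
  by rewrite (umulE (UScal k)) uaddE !gE /= mulr_algl.
have g_mul : monoid_morphism g.
  split; first by rewrite -[1]/(ucls _) gE /= scale1r.
  elim/ucls_ind=> s; elim/ucls_ind=> t.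
  by rewrite -[_ * _]/(umul (ucls s) (ucls t)) umulE !gE.
pose gl := GRing.isLinear.Build K U B *:%R g g_lin.
pose gm := GRing.isMonoidMorphism.Build U B g g_mul.
pose G : {lrmorphism U -> B} := HB.pack g gl gm.
exists G; split=> [x|G' G'f] /=; first by rewrite gE.
elim/ucls_ind=> t; rewrite gE.
elim: t => [k|x|s IHs t IHt|s IHs t IHt] /=.
- have -> : ucls (UScal k) = k%:A :> U.
    by rewrite -[RHS]/(umul (uscal k) (uscal 1)) umulr1.
  by rewrite linearZ rmorph1.
- by rewrite G'f.
- by rewrite -IHs -IHt -raddfD -[_ + _]/(uadd (ucls s) (ucls t)) uaddE.
- by rewrite -IHs -IHt -rmorphM -[_ * _]/(umul (ucls s) (ucls t)) umulE.
Qed.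

End Enveloping.

(* Encoding of sl_2 (x) A: the triple [(a, b, c)] stands for
   x^- (x) a + h (x) b + x^+ (x) c, and the bracket is the bilinear extension of
   [z (x) a, z' (x) b] = [z, z'] (x) a b (see [lie_tens]); [tens_universal] shows
   that this is the tensor product.  For [A = K] one gets [sl_2] itself. *)

Definition sl2_tensor (K : fieldType) (A : comAlgType K) : Type :=
  (A * A * A)%type.

Section Sl2Tensor.
Context (K : fieldType) (A : comAlgType K).

HB.instance Definition _ := GRing.Lmodule.copy (sl2_tensor A) (A * A * A)%type.

Implicit Types (u v w : sl2_tensor A).

Definition cminus u : A := u.1.1.
Definition ch u : A := u.1.2.
Definition cplus u : A := u.2.

Definition sl2_lie u v : sl2_tensor A :=
  (2%:R * (cminus u * ch v - ch u * cminus v),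
   cplus u * cminus v - cminus u * cplus v,
   2%:R * (ch u * cplus v - cplus u * ch v)).

Lemma scale_as_mul (k : K) : exists kA : A, forall a, k *: a = kA * a.
Proof. by exists k%:A => a; rewrite mulr_algl. Qed.

Lemma sl2_tensor_ext u v :
  cminus u = cminus v -> ch u = ch v -> cplus u = cplus v -> u = v.
Proof.
by case: u v => [[a b] c] [[a' b'] c']; rewrite /cminus /ch /cplus /= => -> -> ->.
Qed.

Lemma cminusP k u v : cminus (k *: u + v) = k *: cminus u + cminus v.
Proof. by []. Qed.

Lemma chP k u v : ch (k *: u + v) = k *: ch u + ch v.
Proof. by []. Qed.

Lemma cplusP k u v : cplus (k *: u + v) = k *: cplus u + cplus v.
Proof. by []. Qed.

Let coordP := (cminusP, chP, cplusP).

Lemma cminus_lie u v :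
  cminus (sl2_lie u v) = 2%:R * (cminus u * ch v - ch u * cminus v).
Proof. by []. Qed.

Lemma ch_lie u v :
  ch (sl2_lie u v) = cplus u * cminus v - cminus u * cplus v.
Proof. by []. Qed.

Lemma cplus_lie u v :
  cplus (sl2_lie u v) = 2%:R * (ch u * cplus v - cplus u * ch v).
Proof. by []. Qed.

Let coord_lie := (cminus_lie, ch_lie, cplus_lie).

Lemma sl2_lie_linearl k u v w :
  sl2_lie (k *: u + v) w = k *: sl2_lie u w + sl2_lie v w.
Proof.
have [kA kE] := scale_as_mul k.
by apply: sl2_tensor_ext; rewrite !(coord_lie, coordP) !kE; ring.
Qed.

Lemma sl2_lie_linearr k u v w :
  sl2_lie u (k *: v + w) = k *: sl2_lie u v + sl2_lie u w.
Proof.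
have [kA kE] := scale_as_mul k.
by apply: sl2_tensor_ext; rewrite !(coord_lie, coordP) !kE; ring.
Qed.

Lemma sl2_liexx u : sl2_lie u u = 0.
Proof. by apply: sl2_tensor_ext; rewrite coord_lie -[RHS]/(0 : A); ring. Qed.

Lemma sl2_lie_jacobi u v w :
  sl2_lie u (sl2_lie v w) + sl2_lie v (sl2_lie w u) + sl2_lie w (sl2_lie u v)
  = 0.
Proof.
apply: sl2_tensor_ext; rewrite -[RHS]/(0 : A).
- by rewrite -[LHS]/(cminus _ + cminus _ + cminus _) !coord_lie; ring.
- by rewrite -[LHS]/(ch _ + ch _ + ch _) !coord_lie; ring.
- by rewrite -[LHS]/(cplus _ + cplus _ + cplus _) !coord_lie; ring.
Qed.

HB.instance Definition _ := Lmodule_isLieAlgebra.Build K (sl2_tensor A)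
  sl2_lie_linearl sl2_lie_linearr sl2_liexx sl2_lie_jacobi.

End Sl2Tensor.

Definition sl2 (K : fieldType) : lieAlgType K := sl2_tensor K^o.

Section Sl2.
Context (K : fieldType).

Definition xminus : sl2 K := (1, 0, 0).
Definition hsl2 : sl2 K := (0, 1, 0).
Definition xplus : sl2 K := (0, 0, 1).

Lemma sl2_basis (z : sl2 K) :
  z = cminus z *: xminus + ch z *: hsl2 + cplus z *: xplus.
Proof.
case: z => [[a b] c]; rewrite /cminus /ch /cplus.
by congr (_, _, _); rewrite /= -?[_ *: _]/(_ * _) !(mulr0, mulr1, addr0, add0r).
Qed.

Lemma lie_xplus_xminus : lie xplus xminus = hsl2.
Proof. by congr (_, _, _); rewrite /cminus /ch /cplus /=; ring. Qed.

Lemma lie_h_xplus : lie hsl2 xplus = 2%:R *: xplus.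
Proof.
by congr (_, _, _); rewrite /cminus /ch /cplus /= -?[_ *: _]/(_ * _); ring.
Qed.

Lemma lie_h_xminus : lie hsl2 xminus = - (2%:R *: xminus).
Proof.
by congr (_, _, _); rewrite /cminus /ch /cplus /= -?[_ *: _]/(_ * _); ring.
Qed.

End Sl2.
Arguments xminus {K}.
Arguments hsl2 {K}.
Arguments xplus {K}.

Section Tens.
Context (K : fieldType) (A : comAlgType K).

Definition tens (z : sl2 K) (a : A) : sl2_tensor A :=
  (cminus z *: a, ch z *: a, cplus z *: a).

Lemma lie_tens z z' a b : lie (tens z a) (tens z' b) = tens (lie z z') (a * b).
Proof.
have sE (k : K) (c : A) : k *: c = in_alg A k * c by rewrite mulr_algl.
have minus (p q r s : K) :
    2%:R * ((p *: a) * (s *: b) - (q *: a) * (r *: b))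
    = (2%:R * (p * s - q * r)) *: (a * b) :> A.
  by rewrite !sE rmorphM rmorphB !rmorphM rmorph_nat; ring.
have mid (p q r s : K) :
    (p *: a) * (s *: b) - (q *: a) * (r *: b)
    = (p * s - q * r) *: (a * b) :> A.
  by rewrite !sE rmorphB !rmorphM; ring.
by apply: sl2_tensor_ext; [exact: minus | exact: mid | exact: minus].
Qed.

Lemma tens_linearl a : linear (tens^~ a).
Proof.
move=> k z z'; have E (p q : K) : (k * p + q) *: a = k *: (p *: a) + q *: a.
  by rewrite scalerA -scalerDl.
by apply: sl2_tensor_ext; exact: E.
Qed.

Lemma tens_linearr z : linear (tens z).
Proof.
move=> k a b; have E (p : K) : p *: (k *: a + b) = k *: (p *: a) + p *: b.
  by rewrite scalerDr !scalerA mulrC.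
by apply: sl2_tensor_ext; exact: E.
Qed.

Lemma tens_universal (V : lmodType K) (f : sl2 K -> A -> V) :
  (forall a, linear (f^~ a)) -> (forall z, linear (f z)) ->
  exists g : {linear sl2_tensor A -> V}, (forall z a, g (tens z a) = f z a) /\
    forall g' : {linear sl2_tensor A -> V},
      (forall z a, g' (tens z a) = f z a) -> g' =1 g.
Proof.
move=> fl fr; pose g (u : sl2_tensor A) : V :=
  f xminus (cminus u) + f hsl2 (ch u) + f xplus (cplus u).
have g_lin : linear g.
  move=> k u v; rewrite /g !fr !scalerDr.
  by rewrite [RHS]addrACA; congr (_ + _); rewrite [RHS]addrACA.
pose gl := GRing.isLinear.Build K (sl2_tensor A) V *:%R g g_lin.
pose G : {linear sl2_tensor A -> V} := HB.pack g gl.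
have f0 z : f z 0 = 0.
  have := fr z (-1) 0 0; rewrite scaleN1r addNr => ->.
  by rewrite scaleN1r addNr.
have frZ z k a : f z (k *: a) = k *: f z a by rewrite -[k *: a]addr0 fr f0 addr0.
have fl0 a : f 0 a = 0.
  have := fl a (-1) 0 0; rewrite scaleN1r addNr => ->.
  by rewrite scaleN1r addNr.
exists G; split=> [z a /=|G' G'f].
  have flD x y : f (x + y) a = f x a + f y a.
    by rewrite -[x]scale1r fl !scale1r.
  have flZ k x : f (k *: x) a = k *: f x a by rewrite -[k *: x]addr0 fl fl0 addr0.
  by rewrite /g !frZ [in RHS](sl2_basis z) !flD !flZ.
move=> u /=; rewrite /g -!G'f -!raddfD; congr (G' _).
case: u => [[a b] c]; rewrite /tens /cminus /ch /cplus /=.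
by congr (_, _, _); rewrite /= !(scale0r, scale1r, addr0, add0r).
Qed.

End Tens.


Definition submsets (T : choiceType) (chi : {mset T}) : set {mset T} :=
  [set psi | (psi `<=` chi)%mset].

Lemma size_msetD (T : choiceType) (psi chi : {mset T}) :
  size (psi `+` chi)%mset = (size psi + size chi)%N.
Proof.
rewrite -size_cat; apply: perm_size; apply/allP => a _ /=.
by rewrite count_cat !count_mem_mset msetE2.
Qed.

Lemma size_msetB (T : choiceType) (psi chi : {mset T}) :
  (psi `<=` chi)%mset -> size (chi `\` psi)%mset = (size chi - size psi)%N.
Proof. by move=> /msetBDK {2}<-; rewrite size_msetD addnK. Qed.

Lemma finite_submsets (T : choiceType) (chi : {mset T}) :
  finite_set (submsets chi).
Proof.
have [n] := ubnP (size chi); elim: n chi => // n IHn chi.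
rewrite ltnS => le_n; have [->|chi_neq0] := eqVneq chi mset0.
  apply: (@sub_finite_set _ _ [set mset0]) => // psi.
  by rewrite /submsets /= msubset0 => /eqP.
have [chi0|[a a_chi]] := mset_0Vmem chi; first by rewrite chi0 eqxx in chi_neq0.
have {IHn} fin : finite_set (submsets (chi `\ a)%mset).
  apply: IHn; apply: leq_trans le_n; rewrite -{2}(msetB1K a_chi).
  by rewrite (size_msetD [mset a]%mset) enum_msetn.
apply: (@sub_finite_set _ _ (submsets (chi `\ a)%mset `|`
  [set (a +` psi)%mset | psi in submsets (chi `\ a)%mset])); last first.
  by rewrite finite_setU; split=> //; exact: finite_image.
move=> psi; rewrite /submsets /= => /msubsetP le_psi.
have [a_psi|a_psi] := boolP (a \in psi).
  right; exists (psi `\ a)%mset; last exact: msetB1K.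
  by apply/msubsetP => b; rewrite !msetB1E leq_sub2r.
left; apply/msubsetP => b; rewrite msetB1E; have [->|_] := eqVneq b a.
  by rewrite (mset_eq0P a_psi).
by rewrite subn0.
Qed.

Lemma finite_submsets4 (T : choiceType) (phi chi : {mset T}) :
  finite_set [set q : {mset T} * {mset T} * {mset T} * {mset T} |
    let: (psi1, psi2, phi1, phi2) := q in
    submsets chi (psi1 `+` psi2)%mset /\ submsets phi (phi1 `+` phi2)%mset].
Proof.
have leD (psi psi' xi : {mset T}) : submsets xi (psi `+` psi')%mset ->
    submsets xi psi /\ submsets xi psi'.
  move=> /msubsetP le; split; apply/msubsetP => a; apply: leq_trans (le a);
  by rewrite msetE2 ?leq_addr ?leq_addl.
apply: (@sub_finite_set _ _ (submsets chi `*` submsets chi `*`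
                             submsets phi `*` submsets phi)).
  by move=> [[[? ?] ?] ?] [/leD[? ?] /leD[? ?]].
by do !apply: finite_setX; exact: finite_submsets.
Qed.

Section Garland.
Context (K : fieldType) (A : comAlgType K).
Local Notation F := {mset A}.
Local Notation U := (enveloping (sl2_tensor A)).
Implicit Types (psi phi chi : F) (x : A -> U).

Definition mset_prod psi : A := \prod_(a <- finsupp psi) a ^+ psi a.

Definition multinomial psi : K :=
  (size psi)`!%:R / (\prod_(a <- finsupp psi) (psi a)`!)%:R.

Definition divpow (u : U) (r : nat) : U := (r`!%:R)^-1 *: u ^+ r.

Definition xm (a : A) : U := ugen (tens xminus a).
Definition xp (a : A) : U := ugen (tens xplus a).
Definition hh (a : A) : U := ugen (tens hsl2 a).

Lemma ugen_tens_comm z a b :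
  GRing.comm (ugen (tens z a) : U) (ugen (tens z b)).
Proof.
have tens0 (c : A) : tens 0 c = 0 by apply: sl2_tensor_ext; exact: scale0r.
by apply/eqP; rewrite -subr_eq0 -ugen_lie lie_tens liexx tens0 raddf0.
Qed.

(* The factors commute for [x = xm] and [x = xp] ([ugen_tens_comm]), so the
   order in which [finsupp psi] is enumerated is irrelevant. *)
Definition xprod x psi : U := \prod_(a <- finsupp psi) divpow (x a) (psi a).

(* The values lie in the subalgebra generated by the elements h (x) a, i.e. the
   image of U(C h (x) A).  [n] is fuel; [p phi chi] has enough of it, see
   [p_rec_fuel] and [p_neq0]. *)
Fixpoint p_rec (n : nat) phi chi : U :=
  if size phi != size chi then 0 else if phi == mset0 then 1 else
  if n is n'.+1 then
    - (size phi)%:R^-1 *: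
      \sum_(psi1 \in submsets phi `\ mset0)
        \sum_(psi2 \in submsets chi `\ mset0)
          (multinomial psi1 * multinomial psi2) *:
            (hh (mset_prod psi1 * mset_prod psi2) *
             p_rec n' (phi `\` psi1)%mset (chi `\` psi2)%mset)
  else 0.

Definition p phi chi : U := p_rec (size phi) phi chi.

Lemma p_rec_fuel m n phi chi :
  (size phi <= m)%N -> (size phi <= n)%N -> p_rec m phi chi = p_rec n phi chi.
Proof.
elim: m n phi chi => [|m IHm] [|n] phi chi //=.
- by rewrite leqn0 size_mset_eq0 => /eqP->; rewrite eqxx.
- by move=> _; rewrite leqn0 size_mset_eq0 => /eqP->; rewrite eqxx.
move=> le_m le_n; case: ifP => // _; case: ifP => // _; congr (_ *: _).
apply: eq_fsbigr => psi1; rewrite inE => -[le_psi1 /eqP psi1_neq0].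
apply: eq_fsbigr => psi2 _; congr (_ *: (_ * _)).
have psi1_gt0 : (0 < size (psi1 : F))%N by rewrite lt0n size_mset_eq0.
by apply: IHm; rewrite (size_msetB le_psi1) leq_subLR;
  [apply: leq_trans le_m _ | apply: leq_trans le_n _]; rewrite -add1n leq_add2r.
Qed.

Lemma p00 : p mset0 mset0 = 1.
Proof. by rewrite /p size_mset0 /= eqxx eqxx. Qed.

Lemma p_neq_size phi chi : size phi <> size chi -> p phi chi = 0.
Proof. by move=> /eqP ne; rewrite /p; case: {1}(size phi) => [|n] /=; rewrite ne. Qed.

Lemma p_neq0 phi chi : phi <> mset0 -> chi <> mset0 -> size phi = size chi ->
  p phi chi =
    - (size phi)%:R^-1 *:
      \sum_(psi1 \in submsets phi `\ mset0)
        \sum_(psi2 \in submsets chi `\ mset0)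
          (multinomial psi1 * multinomial psi2) *:
            (hh (mset_prod psi1 * mset_prod psi2) *
             p (phi `\` psi1)%mset (chi `\` psi2)%mset).
Proof.
move=> /eqP phi0 _ eq_size.
rewrite [LHS](@p_rec_fuel _ (size phi).+1) ?leqnSn //=.
rewrite eq_size eqxx /= (negPf phi0); congr (_ *: _).
apply: eq_fsbigr => psi1; rewrite inE => -[le_psi1 _].
apply: eq_fsbigr => psi2 _; congr (_ *: (_ * _)).
by apply: p_rec_fuel => //; rewrite (size_msetB le_psi1) -eq_size leq_subr.
Qed.

(* The value of D^+- at a third argument that is the indicator of [b]. *)
Definition D1 x psi1 psi2 (b : A) : U :=
  (size psi1 == size psi2)%:R *
  ((multinomial psi1 * multinomial psi2) *:
     x (b * (mset_prod psi1 * mset_prod psi2))).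

(* To be used with [n = size psi3]; when it is 1 the sum has one term. *)
Fixpoint D_rec (n : nat) x psi1 psi2 psi3 : U :=
  match n with
  | 0 => (size psi1 + size psi2 == 0)%N%:R
  | 1 => \sum_(b <- finsupp psi3) D1 x psi1 psi2 b
  | n'.+1 =>
    (size psi3)%:R^-1 *:
      \sum_(phi1 \in submsets psi1)
        \sum_(phi2 \in submsets psi2)
          \sum_(b <- finsupp psi3)
            D1 x phi1 phi2 b *
            D_rec n' x (psi1 `\` phi1)%mset (psi2 `\` phi2)%mset
                       (psi3 `\ b)%mset
  end.

Definition D x psi1 psi2 psi3 : U := D_rec (size psi3) x psi1 psi2 psi3.

Lemma D_mset0 x psi1 psi2 :
  D x psi1 psi2 mset0 = (size psi1 + size psi2 == 0)%N%:R.
Proof. by rewrite /D size_mset0. Qed.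

Lemma D_mset1 x psi1 psi2 b :
  D x psi1 psi2 [mset b]%mset =
    (size psi1 == size psi2)%:R *
    ((multinomial psi1 * multinomial psi2) *:
       x (b * (mset_prod psi1 * mset_prod psi2))).
Proof.
by rewrite /D enum_msetn /= finsupp_msetn /= big_seq_fset1.
Qed.

Lemma D_ge2 x psi1 psi2 psi3 : (2 <= size psi3)%N ->
  D x psi1 psi2 psi3 =
    (size psi3)%:R^-1 *:
      \sum_(phi1 \in submsets psi1)
        \sum_(phi2 \in submsets psi2)
          \sum_(b <- finsupp psi3)
            D x phi1 phi2 [mset b]%mset *
            D x (psi1 `\` phi1)%mset (psi2 `\` phi2)%mset (psi3 `\ b)%mset.
Proof.
rewrite {1}/D; case E : (size psi3) => [|[|n]] //= _.
rewrite -/(D_rec n.+1 x) E; congr (_ *: _).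
apply: eq_fsbigr => phi1 _; apply: eq_fsbigr => phi2 _.
apply: eq_big_seq => b; rewrite msuppE => b_psi3.
rewrite -[LHS]/(D1 x phi1 phi2 b * D_rec n.+1 x _ _ _) D_mset1 /D.
by rewrite size_msetB ?msub1set// E enum_msetn subn1.
Qed.

(* The blackboard-bold D. *)
Definition bbD psi1 psi2 psi3 : U :=
  \sum_(phi1 \in submsets psi1)
    \sum_(phi2 \in submsets psi2)
      p phi1 phi2 * D xp (psi1 `\` phi1)%mset (psi2 `\` phi2)%mset psi3.

End Garland.
Arguments xm {K A}.
Arguments xp {K A}.
Arguments hh {K A}.

(* Main.v *)
(* Collect everything in generating series with commuting variables s_a, t_a,
   one pair for each a in A, and put alpha = sum s_a a, beta = sum t_a a and
   q = 1/(1 + alpha beta).  Then x^+(phi) x^-(chi) is the coefficient of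
   s^phi t^chi in exp(x^+ alpha) exp(x^- beta).  The recursions of D and p say
   that, up to signs, they are the coefficients of exp(x^(+-) u/(1 - st)), with a
   third set of variables u, and of P = exp(h log(1 + alpha beta)); so the
   right-hand side is the coefficient of s^phi t^chi in
     exp(x^- beta q) P exp(x^+ alpha q),
   as in the factorization of [1, alpha; 0, 1] [1, 0; beta, 1] in SL_2.  Both
   products have constant term 1 and satisfy, for the Euler operator E of the
   total degree,
     E F = (x^+ alpha + x^- beta + h alpha beta - x^+ alpha^2 beta) F,
   which determines F degree by degree. *)

From HB Require Import structures.
Require Import Defs.
From mathcomp Require Import all_boot all_order all_algebra.
From mathcomp Require Import finmap multiset.
From mathcomp Require Import boolp classical_sets functions cardinality fsbigop.
From mathcomp Require Import reals complex ring zify.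

Set Implicit Arguments.
Unset Strict Implicit.
Unset Printing Implicit Defensive.

Import Order.TTheory GRing.Theory Num.Theory.
Local Open Scope mset_scope.
Local Open Scope classical_set_scope.
Local Open Scope ring_scope.

(* The module keeps the additive structure put on multisets local. *)
Module GarlandFormula.

(** * Reindexing of finite sums *)

Lemma big_bij (R : Type) (idx : R) (op : Monoid.com_law idx) (I J : eqType)
    (s : seq I) (t : seq J) (f : I -> J) (g : J -> I) (F : I -> R) (G : J -> R) :
    uniq s -> uniq t ->
    {in s, forall i, [/\ f i \in t, g (f i) = i & F i = G (f i)]} ->
    {in t, forall j, g j \in s /\ f (g j) = j} ->
  \big[op/idx]_(i <- s) F i = \big[op/idx]_(j <- t) G j.
Proof.
move=> us ut fP gP.
rewrite (eq_big_seq (G \o f)) => [|i /fP[]//].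
rewrite -(big_map f predT); apply: perm_big; apply: uniq_perm => //.
  by rewrite map_inj_in_uniq // => i j /fP[_ gi _] /fP[_ gj _] fij; rewrite -gi fij gj.
move=> j; apply/mapP/idP => [[i /fP[fi _ _] ->]//|/gP[gj fgj]].
by exists (g j).
Qed.

Arguments big_bij {R idx op I J s t} f g {F G}.

Definition spairs (I J : Type) (s : seq I) (t : I -> seq J) : seq (I * J) :=
  [seq (i, j) | i <- s, j <- t i].

Lemma mem_spairs (I J : eqType) (s : seq I) (t : I -> seq J) p :
  (p \in spairs s t) = (p.1 \in s) && (p.2 \in t p.1).
Proof.
case: p => i j; apply/allpairsPdep/andP => /= [[i' [j' [si tj [-> ->]]]]//|[si tj]].
by exists i, j.
Qed.

Lemma spairs_uniq (I J : eqType) (s : seq I) (t : I -> seq J) :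
  uniq s -> (forall i, uniq (t i)) -> uniq (spairs s t).
Proof. by move=> us ut; apply: allpairs_uniq_dep => // -[i j] [i' j'] _ _ [-> ->]. Qed.

Lemma big_spairs (R : Type) (idx : R) (op : Monoid.law idx) (I J : Type)
    (s : seq I) (t : I -> seq J) (F : I -> J -> R) :
  \big[op/idx]_(i <- s) \big[op/idx]_(j <- t i) F i j =
  \big[op/idx]_(p <- spairs s t) F p.1 p.2.
Proof. by rewrite big_allpairs_dep. Qed.

(** * Graded monoids with finitely many decompositions *)

(** The exponents of power series: finitely many decompositions make the Cauchy product a finite
    sum, and having only [0] in degree 0 permits induction on the degree. *)
HB.mixin Record Nmodule_isGraded M of GRing.Nmodule M := {
  decomp : M -> seq (M * M);
  deg : M -> nat;
  decomp_uniq : forall m, uniq (decomp m);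
  mem_decomp : forall m p, (p \in decomp m) = (p.1 + p.2 == m);
  degD : forall m n, deg (m + n) = (deg m + deg n)%N;
  deg_eq0 : forall m, (deg m == 0%N) = (m == 0)
}.

#[short(type="gradedNmodType")]
HB.structure Definition GradedNmodule := {M of Nmodule_isGraded M & GRing.Nmodule M}.

Section GradedTheory.
Variable M : gradedNmodType.
Implicit Types m n : M.

Lemma deg0 : deg (0 : M) = 0%N.
Proof. by apply/eqP; rewrite deg_eq0. Qed.

Lemma decompP m (p : M * M) : reflect (p.1 + p.2 = m) (p \in decomp m).
Proof. by rewrite mem_decomp; apply: eqP. Qed.

Lemma addr_eq0_graded m n : (m + n == 0) = (m == 0) && (n == 0).
Proof. by rewrite -!deg_eq0 degD addn_eq0. Qed.

End GradedTheory.

Section Pairs.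
Variables M N : gradedNmodType.

Let dec (m : M * N) : seq ((M * N) * (M * N)) :=
  [seq ((p.1, q.1), (p.2, q.2)) | p <- decomp m.1, q <- decomp m.2].

Let dec_uniq m : uniq (dec m).
Proof.
apply: allpairs_uniq; try exact: decomp_uniq.
by move=> [[a b] [c d]] [[a' b'] [c' d']] _ _ [-> -> -> ->].
Qed.

Let mem_dec m (p : _ * _) : (p \in dec m) = (p.1 + p.2 == m).
Proof.
case: m p => m n [[a b] [c d]].
apply/allpairsP/eqP => /= [[[[x y] [z t]] [/decompP /= <- /decompP /= <-]]|[<- <-]].
  by case=> -> -> -> ->.
by exists ((a, c), (b, d)); split=> //; apply/decompP.
Qed.

Let degDp (m n : M * N) :
  (deg (m + n)%R.1 + deg (m + n)%R.2 = (deg m.1 + deg m.2) + (deg n.1 + deg n.2))%N.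
Proof. by rewrite !degD addnACA. Qed.

Let deg_eq0p (m : M * N) : (deg m.1 + deg m.2 == 0)%N = (m == 0).
Proof. by case: m => m n; rewrite addn_eq0 !deg_eq0. Qed.

HB.instance Definition _ := Nmodule_isGraded.Build (M * N)%type
  dec_uniq mem_dec degDp deg_eq0p.

Lemma big_decomp_pair (R : Type) (idx : R) (op : Monoid.law idx) (m : M * N)
    (F : (M * N) * (M * N) -> R) :
  \big[op/idx]_(p <- decomp m) F p =
  \big[op/idx]_(p <- decomp m.1) \big[op/idx]_(q <- decomp m.2)
    F ((p.1, q.1), (p.2, q.2)).
Proof. by rewrite big_allpairs_dep. Qed.

Lemma deg_pair (m : M * N) : deg m = (deg m.1 + deg m.2)%N.
Proof. by []. Qed.

End Pairs.

(** * Multisets as a graded monoid *)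

Section Multisets.
Variable T : choiceType.
Local Notation F := {mset T}.

HB.instance Definition _ := Choice.on F.
HB.instance Definition _ :=
  GRing.isNmodule.Build F (@msetDA T) (@msetDC T) (@mset0D T).

Let dec (m : F) : seq (F * F) :=
  [seq (psi, (m `\` psi)%mset) | psi <- fset_set (submsets m)].

Let dec_uniq m : uniq (dec m).
Proof. by rewrite map_inj_uniq ?fset_uniq // => a b []. Qed.

Let mem_dec m (p : _ * _) : (p \in dec m) = (p.1 + p.2 == m).
Proof.
case: p => a b; apply/mapP/eqP => /= [[psi]|<-].
  rewrite in_fset_set ?inE; last exact: finite_submsets.
  by move=> /msetBDKC + [-> ->].
exists a.
  rewrite in_fset_set ?inE; last exact: finite_submsets.
  by apply/msubsetP => x; rewrite msetE2 leq_addr.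
by congr (_, _); rewrite -[a + b]/(a `+` b)%mset msetDKB.
Qed.

Let degDm (m n : F) : size ((m + n)%R : F) = (size m + size n)%N.
Proof. exact: size_msetD. Qed.

HB.instance Definition _ := Nmodule_isGraded.Build F
  dec_uniq mem_dec degDm (@size_mset_eq0 T).

Lemma deg_mset (m : F) : deg m = size m. Proof. by []. Qed.

(** Turns the sums over sub-multisets in the definitions of [p], [D] and [bbD] into sums of the
    shape of a Cauchy product. *)
Lemma sum_submsets (V : nmodType) (m : F) (G : F -> V) :
  \sum_(psi \in submsets m) G psi = \sum_(p <- decomp m) G p.1.
Proof.
rewrite fsbig_finite; last exact: finite_submsets.
by rewrite big_map.
Qed.

End Multisets.

(** * Power series *)

(** A name of its own, so that the product can be the Cauchy product rather than the pointwise
    product of functions. *)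
Definition series (M B : Type) := M -> B.

Section SeriesZmod.
Variables (M : Type) (B : zmodType).
HB.instance Definition _ := GRing.Zmodule.copy (series M B) (M -> B).

Lemma seriesD (f g : series M B) m : (f + g) m = f m + g m. Proof. by []. Qed.
Lemma seriesN (f : series M B) m : (- f) m = - f m. Proof. by []. Qed.
Lemma series0 m : (0 : series M B) m = 0. Proof. by []. Qed.
Lemma series_sum I (r : seq I) (P : pred I) (f : I -> series M B) m :
  (\sum_(i <- r | P i) f i) m = \sum_(i <- r | P i) f i m.
Proof. by elim/big_rec2: _ => // i x y _ <-. Qed.
Lemma seriesMn (f : series M B) n m : (f *+ n) m = f m *+ n.
Proof. by elim: n => // n IHn; rewrite !mulrS seriesD IHn. Qed.
End SeriesZmod.

Section SeriesRing.
Variables (M : gradedNmodType) (B : nzRingType).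
Implicit Types f g h : series M B.

Definition series_one : series M B := fun m => (m == 0)%:R.
Definition series_mul f g : series M B :=
  fun m => \sum_(p <- decomp m) f p.1 * g p.2.

Lemma series_mulA : associative series_mul.
Proof.
move=> f g h; apply/funext => m; rewrite /series_mul.
under eq_bigr do rewrite mulr_sumr.
under [RHS]eq_bigr do rewrite mulr_suml.
(* Both sides run over the triples with sum [m]; the two maps rebracket a triple. *)
rewrite !big_spairs; apply: (big_bij
  (fun p => ((p.1.1 + p.2.1, p.2.2), (p.1.1, p.2.1)))
  (fun p => ((p.2.1, p.2.2 + p.1.2), (p.2.2, p.1.2)))).
- by apply: spairs_uniq => *; exact: decomp_uniq.
- by apply: spairs_uniq => *; exact: decomp_uniq.
- move=> [[a b] [c d]]; rewrite !mem_spairs !mem_decomp /=.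
  by move=> /andP[/eqP<- /eqP<-]; rewrite addrA !eqxx mulrA.
- move=> [[a b] [c d]]; rewrite !mem_spairs !mem_decomp /=.
  by move=> /andP[/eqP<- /eqP<-]; rewrite addrA !eqxx.
Qed.

Lemma series_mul1 : left_id series_one series_mul.
Proof.
move=> f; apply/funext => m; rewrite /series_mul /series_one.
rewrite (bigD1_seq (0, m)) ?decomp_uniq ?mem_decomp /= ?add0r // eqxx mul1r.
rewrite big_seq_cond big1 ?addr0 // => -[a b] /andP[/decompP /= <-].
have [->|_ _] := eqVneq a 0; last by rewrite mul0r.
by rewrite add0r eqxx.
Qed.

Lemma series_mulr1 : right_id series_one series_mul.
Proof.
move=> f; apply/funext => m; rewrite /series_mul /series_one.
rewrite (bigD1_seq (m, 0)) ?decomp_uniq ?mem_decomp /= ?addr0 // eqxx mulr1.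
rewrite big_seq_cond big1 ?addr0 // => -[a b] /andP[/decompP /= <-].
have [->|_ _] := eqVneq b 0; last by rewrite mulr0.
by rewrite addr0 eqxx.
Qed.

Lemma series_mulDl : left_distributive series_mul +%R.
Proof.
move=> f g h; apply/funext => m; rewrite seriesD /series_mul -big_split /=.
by apply: eq_bigr => p _; rewrite seriesD mulrDl.
Qed.

Lemma series_mulDr : right_distributive series_mul +%R.
Proof.
move=> f g h; apply/funext => m; rewrite seriesD /series_mul -big_split /=.
by apply: eq_bigr => p _; rewrite seriesD mulrDr.
Qed.

Lemma series_one_neq0 : series_one != 0.
Proof.
apply/eqP => /(congr1 (fun f : series M B => f 0)); rewrite /series_one eqxx.
by apply/eqP; exact: oner_neq0.
Qed.

HB.instance Definition _ := GRing.Zmodule_isNzRing.Build (series M B)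
  series_mulA series_mul1 series_mulr1 series_mulDl series_mulDr series_one_neq0.

Lemma seriesM f g m : (f * g) m = \sum_(p <- decomp m) f p.1 * g p.2.
Proof. by []. Qed.

Lemma series1 m : (1 : series M B) m = (m == 0)%:R. Proof. by []. Qed.

Lemma seriesM0 f g : (f * g) 0 = f 0 * g 0.
Proof.
rewrite seriesM (bigD1_seq (0, 0)) ?decomp_uniq ?mem_decomp /= ?addr0 //.
rewrite big_seq_cond big1 ?addr0 // => -[a b] /andP[/decompP /= /eqP].
by rewrite addr_eq0_graded => /andP[/eqP-> /eqP->]; rewrite eqxx.
Qed.

Definition euler f : series M B := fun m => f m *+ deg m.

Lemma eulerD f g : euler (f + g) = euler f + euler g.
Proof. by apply/funext => m; rewrite /euler !seriesD mulrnDl. Qed.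

Lemma eulerN f : euler (- f) = - euler f.
Proof. by apply/funext => m; rewrite /euler !seriesN mulNrn. Qed.

Lemma eulerM f g : euler (f * g) = euler f * g + f * euler g.
Proof.
apply/funext => m; rewrite /euler seriesD !seriesM -sumrMnl -big_split /=.
apply: eq_big_seq => p /decompP <-.
by rewrite degD mulrnDr mulrnAl mulrnAr.
Qed.

Lemma euler1 : euler 1 = 0.
Proof.
apply/funext => m; rewrite /euler series1 -[RHS]/0.
by case: eqVneq => [->|]; rewrite ?deg0 ?mul0rn.
Qed.

Definition ord_ge (n : nat) f := forall m, (deg m < n)%N -> f m = 0.

Lemma ord_ge0 f : ord_ge 0 f. Proof. by []. Qed.

Lemma ord_geM n k f g : ord_ge n f -> ord_ge k g -> ord_ge (n + k) (f * g).
Proof.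
move=> fn gk m lt_m; rewrite seriesM big_seq big1 // => p /decompP pm.
have [/fn->|le_n] := ltnP (deg p.1) n; first by rewrite mul0r.
have [/gk->|le_k] := ltnP (deg p.2) k; first by rewrite mulr0.
by move: lt_m; rewrite -pm degD ltnNge leq_add.
Qed.

Lemma ord_geX f n : f 0 = 0 -> ord_ge n (f ^+ n).
Proof.
move=> f0; elim: n => [|n IHn]; first exact: ord_ge0.
rewrite exprS -add1n; apply: ord_geM IHn => m.
by rewrite ltnS leqn0 deg_eq0 => /eqP->.
Qed.

(** In every decomposition of [m] other than [(m, 0)] the first part has degree below [n], where [f]
    vanishes. *)
Lemma seriesM_lead n f g m : ord_ge n f -> deg m = n -> (f * g) m = f m * g 0.
Proof.
move=> fn dm.
rewrite seriesM (bigD1_seq (m, 0)) ?decomp_uniq ?mem_decomp /= ?addr0 //.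
rewrite big_seq_cond big1 ?addr0 // => -[a b] /andP[/decompP /= pm ne].
rewrite fn ?mul0r // -dm -pm degD -addn1 leq_add2l lt0n deg_eq0.
by apply: contraNneq ne => b0; move: pm; rewrite b0 addr0 => ->.
Qed.

Lemma seriesM_leadr n f g m : ord_ge n g -> deg m = n -> (f * g) m = f 0 * g m.
Proof.
move=> gn dm.
rewrite seriesM (bigD1_seq (0, m)) ?decomp_uniq ?mem_decomp /= ?add0r //.
rewrite big_seq_cond big1 ?addr0 // => -[a b] /andP[/decompP /= pm ne].
rewrite gn ?mulr0 // -dm -pm degD -add1n leq_add2r lt0n deg_eq0.
by apply: contraNneq ne => a0; move: pm; rewrite a0 add0r => ->.
Qed.

End SeriesRing.

Section SeriesComRing.
Variables (M : gradedNmodType) (B : comNzRingType).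

Lemma decomp_swap (V : nmodType) (m : M) (F : M * M -> V) :
  \sum_(p <- decomp m) F p = \sum_(p <- decomp m) F (p.2, p.1).
Proof.
apply: (big_bij (fun p => (p.2, p.1)) (fun p => (p.2, p.1)));
  try exact: decomp_uniq.
- by move=> [a b]; rewrite !mem_decomp /= addrC.
- by move=> [a b]; rewrite !mem_decomp /= addrC.
Qed.

Lemma series_mulC : commutative (@series_mul M B).
Proof.
move=> f g; apply/funext => m; rewrite /series_mul decomp_swap.
by apply: eq_bigr => p _; rewrite mulrC.
Qed.

HB.instance Definition _ :=
  GRing.PzRing_hasCommutativeMul.Build (series M B) series_mulC.
End SeriesComRing.

Section SeriesAlg.
Variables (K : pzRingType) (M : gradedNmodType) (B : algType K).
Implicit Types f g h : series M B.

Definition series_scale (k : K) f : series M B := fun m => k *: f m.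

Let scaleA k l f : series_scale k (series_scale l f) = series_scale (k * l) f.
Proof. by apply/funext => m; rewrite /series_scale scalerA. Qed.
Let scale1 : left_id 1 series_scale.
Proof. by move=> f; apply/funext => m; rewrite /series_scale scale1r. Qed.
Let scaleDr : right_distributive series_scale +%R.
Proof. by move=> k f g; apply/funext => m; rewrite /series_scale scalerDr. Qed.
Let scaleDl f : {morph series_scale^~ f : k l / k + l}.
Proof. by move=> k l; apply/funext => m; rewrite /series_scale scalerDl. Qed.
HB.instance Definition _ :=
  GRing.Zmodule_isLmodule.Build K (series M B) scaleA scale1 scaleDr scaleDl.

Lemma seriesZ k f m : (k *: f) m = k *: f m. Proof. by []. Qed.

Let scaleAl k f g : k *: (f * g) = k *: f * g.
Proof.
apply/funext => m; rewrite seriesZ !seriesM scaler_sumr.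
by apply: eq_bigr => p _; rewrite seriesZ scalerAl.
Qed.
HB.instance Definition _ := GRing.Lmodule_isLalgebra.Build K (series M B) scaleAl.

Let scaleAr k f g : k *: (f * g) = f * (k *: g).
Proof.
apply/funext => m; rewrite seriesZ !seriesM scaler_sumr.
by apply: eq_bigr => p _; rewrite seriesZ scalerAr.
Qed.
HB.instance Definition _ := GRing.Lalgebra_isAlgebra.Build K (series M B) scaleAr.

Lemma eulerZ k f : euler (k *: f) = k *: euler f.
Proof. by apply/funext => m; rewrite /euler !seriesZ scalerMnr. Qed.

End SeriesAlg.

(** * Additive maps applied to coefficients *)

Section SeriesMap.
Variables (M : gradedNmodType) (B C : zmodType) (x : {additive B -> C}).
Definition smap (f : series M B) : series M C := fun m => x (f m).

Lemma smapD f g : smap (f + g) = smap f + smap g.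
Proof. by apply/funext => m; rewrite seriesD /smap raddfD. Qed.
Lemma smapN f : smap (- f) = - smap f.
Proof. by apply/funext => m; rewrite seriesN /smap raddfN. Qed.
Lemma smapMn f n : smap (f *+ n) = smap f *+ n.
Proof. by apply/funext => m; rewrite /smap !seriesMn raddfMn. Qed.
End SeriesMap.

Lemma smap_euler (M : gradedNmodType) (B C : nzRingType)
  (x : {additive B -> C}) (f : series M B) : euler (smap x f) = smap x (euler f).
Proof. by apply/funext => m; rewrite /euler /smap raddfMn. Qed.

(** The variables commute with everything, so a commutation rule for coefficients passes to series.
    The multiple [n] is 1 for [x^+, x^-], 2 for brackets with h, and 0 for commuting elements. *)
Lemma smap_bracket (M : gradedNmodType) (A : comNzRingType) (B : nzRingType)
    (x y z : {additive A -> B}) (n : nat) (f g : series M A) :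
    (forall a b, x a * y b - y b * x a = z (a * b) *+ n) ->
  smap x f * smap y g - smap y g * smap x f = smap z (f * g) *+ n.
Proof.
move=> xyz; apply/funext => m.
rewrite seriesD seriesN seriesMn !seriesM /smap seriesM.
rewrite (decomp_swap m (fun p => y (g p.1) * x (f p.2))) -sumrB raddf_sum -sumrMnl.
by apply: eq_bigr => p _; rewrite xyz.
Qed.

(** At [m] the equation reads [deg m] times [f m] equals a sum of terms [Y p.1 * f p.2]. Since
    [Y 0 = 0], only values of [f] in lower degree enter, and induction on the degree applies. *)
Lemma euler_unique (K : numFieldType) (M : gradedNmodType) (B : algType K)
    (Y f : series M B) : Y 0 = 0 -> f 0 = 0 -> euler f = Y * f -> f = 0.
Proof.
move=> Y0 f0 Ef; apply/funext => m.
have [n] := ubnP (deg m); elim: n m => // n IHn m lt_m.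
have [->|m0] := eqVneq m 0; first by rewrite f0.
have : euler f m = 0.
  rewrite Ef seriesM big_seq big1 // => p /decompP pm.
  have [->|p0] := eqVneq p.1 0; first by rewrite Y0 mul0r.
  rewrite IHn ?mulr0 //; move: lt_m; rewrite -pm degD ltnS.
  by apply: leq_trans; rewrite -add1n leq_add2r lt0n deg_eq0.
rewrite /euler -scaler_nat => /eqP.
by rewrite scaler_eq0 pnatr_eq0 deg_eq0 (negPf m0) => /eqP.
Qed.

Lemma mulrn_injS (K : numFieldType) (V : lmodType K) (n : nat) (u v : V) :
  u *+ n.+1 = v *+ n.+1 -> u = v.
Proof.
rewrite -!(scaler_nat (R := K)) => /(congr1 ( *:%R (n.+1%:R^-1 : K))).
by rewrite !scalerA mulVf ?pnatr_eq0 // !scale1r.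
Qed.

(** * Exponentials *)

Section Exponential.
Variables (K : numFieldType) (M : gradedNmodType) (B : algType K).
Implicit Types X Y Z : series M B.

Definition dpow X (r : nat) : series M B := (r`!%:R : K)^-1 *: X ^+ r.

(** When [X 0 = 0], the powers with [r > deg m] vanish at [m], so this finite sum is the full
    exponential there. *)
Definition sexp X : series M B := fun m => \sum_(r < (deg m).+1) dpow X r m.

Lemma dpow0 X : dpow X 0 = 1.
Proof. by rewrite /dpow fact0 invr1 scale1r expr0. Qed.

Lemma dpowS X r : dpow X r.+1 *+ r.+1 = X * dpow X r.
Proof.
rewrite /dpow -scalerAr -exprS scalerMnl -mulr_natr factS natrM invfM.
by rewrite mulrAC mulVf ?mul1r // pnatr_eq0.
Qed.

Lemma dpow_ord X r : X 0 = 0 -> ord_ge r (dpow X r).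
Proof. by move=> /(@ord_geX _ _ _ r) Xr m /Xr Xm; rewrite /dpow seriesZ Xm scaler0. Qed.

Lemma sexp_trunc X n m : X 0 = 0 -> (deg m < n)%N ->
  sexp X m = \sum_(r < n) dpow X r m.
Proof.
move=> X0 le_n; rewrite /sexp -(subnKC le_n) big_split_ord /=.
by rewrite [X in _ + X]big1 ?addr0 // => i _; rewrite dpow_ord //= leq_addr.
Qed.

Lemma sexp0 X : X 0 = 0 -> sexp X 0 = 1.
Proof. by move=> X0; rewrite /sexp deg0 big_ord1 dpow0 series1 eqxx. Qed.

Lemma sexpM X Y n m : X 0 = 0 -> (deg m < n)%N ->
  (sexp X * Y) m = \sum_(r < n) (dpow X r * Y) m.
Proof.
move=> X0 lt_m; under [RHS]eq_bigr do rewrite seriesM.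
rewrite seriesM exchange_big; apply: eq_big_seq => p /decompP pm.
rewrite (sexp_trunc (n := n)) ?mulr_suml //.
by apply: leq_ltn_trans lt_m; rewrite -pm degD leq_addr.
Qed.

Lemma sexpMr X Y n m : X 0 = 0 -> (deg m < n)%N ->
  (Y * sexp X) m = \sum_(r < n) (Y * dpow X r) m.
Proof.
move=> X0 lt_m; under [RHS]eq_bigr do rewrite seriesM.
rewrite seriesM exchange_big; apply: eq_big_seq => p /decompP pm.
rewrite (sexp_trunc (n := n)) ?mulr_sumr //.
by apply: leq_ltn_trans lt_m; rewrite -pm degD leq_addl.
Qed.

(* [X^(r - s)] as a divided power, and [0] when [r < s]. *)
Definition dpow_pred X (s r : nat) := if (s <= r)%N then dpow X (r - s) else 0.

(** The degree [r] part in [X] of exp(X) Y = (exp(ad X) Y) exp(X), where [Z] = [X, Y] and [W] = [X,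
    [X, Y]] / 2. As [W] commutes with [X], the series exp(ad X) Y stops there. *)
Lemma dpow_conj X Y Z W r :
    X * Y - Y * X = Z -> X * Z - Z * X = W *+ 2 -> X * W = W * X ->
  dpow X r * Y = Y * dpow X r + Z * dpow_pred X 1 r + W * dpow_pred X 2 r.
Proof.
move=> /(canRL (subrK _)) XY /(canRL (subrK _)) XZ XW.
elim: r => [|r IHr]; first by rewrite /dpow_pred dpow0 mulr1 mul1r !mulr0 !addr0.
apply: (@mulrn_injS _ _ r).
rewrite -mulrnAl dpowS -mulrA IHr !mulrDr !mulrA XY XZ XW !mulrDl -!mulrA.
(* Coefficient of [W]: in divided powers, 2 X^(r-1) + (r-1) X^(r-1) = (r+1) X^(r-1). For [r < 2]
   some of the terms are the default 0 of [dpow_pred]. [X1] below is the same count for [Z]. *)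
have X2 : dpow_pred X 1 r *+ 2 + X * dpow_pred X 2 r = dpow_pred X 2 r.+1 *+ r.+1.
  rewrite {3}/dpow_pred ltnS subSS -/(dpow_pred X 1 r).
  case: r {IHr} => [|[|r]]; rewrite /dpow_pred /=.
  - by rewrite mulr0 !mul0rn addr0.
  - by rewrite mulr0 addr0.
  - by rewrite subn1 subn2 /= -(addn2 r.+1) mulrnDr addrC dpowS.
have X1 : dpow X r + X * dpow_pred X 1 r = dpow_pred X 1 r.+1 *+ r.+1.
  rewrite {2}/dpow_pred /= subSS subn0 mulrSr addrC; congr (_ + _).
  by case: r {IHr X2} => [|r]; rewrite /dpow_pred /= ?mulr0 // subSS subn0 dpowS.
rewrite !mulrnDl -!mulrnAr dpowS -X1 -X2 mulr2n !mulrDr -!addrA addrCA.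
congr (_ + (_ + _)); rewrite [RHS]addrCA; congr (_ + _).
by rewrite [RHS]addrCA.
Qed.

Lemma sexp_conj X Y Z W : X 0 = 0 ->
    X * Y - Y * X = Z -> X * Z - Z * X = W *+ 2 -> X * W = W * X ->
  sexp X * Y = (Y + Z + W) * sexp X.
Proof.
move=> X0 XY XZ XW; apply/funext => m.
(* Large enough that after a shift by [s <= 2] the sum still contains all powers up to [deg m]. *)
set n := (deg m).+3.
have pred_sum s : (s <= 2)%N -> forall V,
    (V * sexp X) m = \sum_(r < n) (V * dpow_pred X s r) m.
  move=> s2 V; rewrite (@sexpMr _ _ (n - s)) //; last by rewrite /n; lia.
  rewrite -[in RHS](subnKC (leq_trans s2 (isT : 2 <= n)%N)) big_split_ord /=.
  rewrite [X in _ = X + _]big1 ?add0r => [|i _].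
    by apply: eq_bigr => i _; rewrite /dpow_pred leq_addr addKn.
  by rewrite /dpow_pred leqNgt ltn_ord mulr0.
rewrite !mulrDl !seriesD (pred_sum 0%N _ Y) // (pred_sum 1%N _ Z) // (pred_sum 2%N _ W) //.
rewrite (@sexpM _ _ n) //; last by rewrite /n; lia.
rewrite -!big_split /=; apply: eq_bigr => r _.
by rewrite (dpow_conj r XY XZ XW) !seriesD [dpow_pred X 0 r]/dpow_pred subn0.
Qed.

(** The chain rule for the derivation [euler]; commutation of [X] with its derivative gives the
    usual derivative of each power. *)
Lemma sexp_euler X : X 0 = 0 -> X * euler X = euler X * X ->
  euler (sexp X) = euler X * sexp X.
Proof.
move=> X0 XE.
have EX r : euler (X ^+ r.+1) = euler X * X ^+ r *+ r.+1.
  elim: r => [|r IHr]; first by rewrite !expr1 expr0 mulr1.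
  rewrite exprS eulerM IHr -mulrnAr mulrA XE -mulrA mulrnAr -exprS.
  by rewrite mulrnAr [RHS]mulrS.
have Ed r : euler (dpow X r.+1) = euler X * dpow X r.
  rewrite /dpow eulerZ EX -scalerAr -scalerMnr scalerMnl -mulr_natr factS natrM.
  by rewrite invfM mulrAC mulVf ?mul1r // pnatr_eq0.
apply/funext => m.
have -> : euler (sexp X) m = \sum_(r < (deg m).+2) euler (dpow X r) m.
  by rewrite /euler (@sexp_trunc _ (deg m).+2) // -sumrMnl.
rewrite big_ord_recl dpow0 euler1 series0 add0r (@sexpMr _ _ (deg m).+1) //.
by apply: eq_bigr => r _; rewrite -Ed.
Qed.

End Exponential.

(** * Change of variables *)

(** A substitution of variables by variables, seen on exponents. Finite fibres let [push] add up the
    coefficients that land on the same monomial, which gives a ring homomorphism of series. *)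
Record fibmap (M N : gradedNmodType) := Fibmap {
  fibmap_fun :> M -> N;
  fib : N -> seq M;
  fibmapD : {morph fibmap_fun : m n / m + n};
  fibmap_deg : forall m, deg (fibmap_fun m) = deg m;
  fib_uniq : forall n, uniq (fib n);
  mem_fib : forall n m, (m \in fib n) = (fibmap_fun m == n)
}.

Section PushDef.
Variables (M N : gradedNmodType) (g : fibmap M N).

Definition push (B : nmodType) (f : series M B) : series N B :=
  fun n => \sum_(m <- fib g n) f m.

Lemma fibmap_eq0 m : (g m == 0) = (m == 0).
Proof. by rewrite -!deg_eq0 fibmap_deg. Qed.

Lemma push0 (B : nmodType) (f : series M B) : push f 0 = f 0.
Proof.
rewrite /push (bigD1_seq 0) ?fib_uniq ?mem_fib ?fibmap_eq0 //=.
rewrite big_seq_cond big1 ?addr0 // => m; rewrite mem_fib fibmap_eq0.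
by move=> /andP[/eqP->]; rewrite eqxx.
Qed.

Lemma push_smap (B C : zmodType) (x : {additive B -> C}) (f : series M B) :
  push (smap x f) = smap x (push f).
Proof. by apply/funext => n; rewrite /push /smap raddf_sum. Qed.

Lemma push1 (B : nzRingType) : push (1 : series M B) = 1.
Proof.
apply/funext => n; have [->|n0] := eqVneq n 0; first by rewrite push0 !series1 !eqxx.
rewrite series1 (negPf n0) /push big_seq big1 // => m; rewrite mem_fib => /eqP gm.
by rewrite series1 -fibmap_eq0 gm (negPf n0).
Qed.

(** Both sides sum [f k * h l] over the pairs with [g (k + l) = n]. *)
Lemma pushM (B : nzRingType) (f h : series M B) : push (f * h) = push f * push h.
Proof.
apply/funext => n; rewrite seriesM {1}/push.
transitivity (\sum_(p <- decomp n)
    \sum_(k <- fib g p.1) \sum_(l <- fib g p.2) f k * h l); last first.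
  by apply: eq_bigr => p _; rewrite mulr_suml; apply: eq_bigr => k _; rewrite mulr_sumr.
rewrite (eq_bigr (fun p => \sum_(kl <- spairs (fib g p.1) (fun=> fib g p.2))
   f kl.1 * h kl.2)) => [|p _]; last by rewrite big_spairs.
rewrite (eq_bigr (fun m => \sum_(p <- decomp m) f p.1 * h p.2)) => [|//].
rewrite !big_spairs; apply: (big_bij
  (fun q => ((g q.2.1, g q.2.2), (q.2.1, q.2.2)))
  (fun q => (q.2.1 + q.2.2, (q.2.1, q.2.2)))).
- by apply: spairs_uniq => *; rewrite (fib_uniq, decomp_uniq).
- by apply: spairs_uniq => *; rewrite ?spairs_uniq ?decomp_uniq // => *; exact: fib_uniq.
- move=> [m [k l]]; rewrite !mem_spairs !mem_decomp !mem_fib /=.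
  by move=> /andP[/eqP<- /eqP<-]; rewrite fibmapD !eqxx.
- move=> [[m1 m2] [k l]]; rewrite !mem_spairs !mem_decomp !mem_fib /=.
  by move=> /and3P[/eqP<- /eqP<- /eqP<-]; rewrite fibmapD !eqxx.
Qed.

(** [push] respects powers, and since [g] preserves the degree, [sexp] is truncated at the same
    place on both sides. *)
Lemma push_sexp (K : numFieldType) (B : algType K) (X : series M B) :
  push (sexp X) = sexp (push X).
Proof.
have push_dpow r : push (dpow X r) = dpow (push X) r.
  have pushX : push (X ^+ r) = push X ^+ r.
    by elim: r => [|r IHr]; rewrite ?expr0 ?push1 // !exprS pushM IHr.
  rewrite /dpow -pushX; apply/funext => n.
  by rewrite seriesZ /push scaler_sumr.
apply/funext => n; rewrite /sexp; under [RHS]eq_bigr do rewrite -push_dpow.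
rewrite {2}/push exchange_big; apply: eq_big_seq => m.
by rewrite mem_fib => /eqP <-; rewrite fibmap_deg.
Qed.

End PushDef.

Section FibmapInl.
Variables M N : gradedNmodType.

(** [fibmap_inl] and [fibmap_inr] regard a series in one of two sets of variables as a series in
    both. *)
Let inl_fun (m : M) : M * N := (m, 0).
Let inl_fib (n : M * N) := if n.2 == 0 then [:: n.1] else [::].
Let inlD : {morph inl_fun : m n / m + n}.
Proof. by move=> m n; congr (_, _); rewrite addr0. Qed.
Let inl_deg m : deg (inl_fun m) = deg m.
Proof. by rewrite deg_pair deg0 addn0. Qed.
Let inl_uniq n : uniq (inl_fib n).
Proof. by rewrite /inl_fib; case: ifP. Qed.
Let mem_inl n m : (m \in inl_fib n) = (inl_fun m == n).
Proof.
rewrite /inl_fib -pair_eqE /= [0 == _]eq_sym; case: ifP => _.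
  by rewrite inE andbT.
by rewrite in_nil andbF.
Qed.
Definition fibmap_inl := Fibmap inlD inl_deg inl_uniq mem_inl.

Let inr_fun (n : N) : M * N := (0, n).
Let inr_fib (n : M * N) := if n.1 == 0 then [:: n.2] else [::].
Let inrD : {morph inr_fun : m n / m + n}.
Proof. by move=> m n; congr (_, _); rewrite addr0. Qed.
Let inr_deg m : deg (inr_fun m) = deg m.
Proof. by rewrite deg_pair deg0. Qed.
Let inr_uniq n : uniq (inr_fib n).
Proof. by rewrite /inr_fib; case: ifP. Qed.
Let mem_inr n m : (m \in inr_fib n) = (inr_fun m == n).
Proof.
rewrite /inr_fib -pair_eqE /= [0 == _]eq_sym; case: ifP => _.
  by rewrite inE.
by rewrite in_nil.
Qed.
Definition fibmap_inr := Fibmap inrD inr_deg inr_uniq mem_inr.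

Lemma push_inl (B : nzRingType) (f : series M B) m :
  push fibmap_inl f m = f m.1 * (1 : series N B) m.2.
Proof.
rewrite /push /= /inl_fib series1; case: ifP => _.
  by rewrite big_seq1 mulr1.
by rewrite big_nil mulr0.
Qed.

Lemma push_inr (B : nzRingType) (f : series N B) m :
  push fibmap_inr f m = (1 : series M B) m.1 * f m.2.
Proof.
rewrite /push /= /inr_fib series1; case: ifP => _.
  by rewrite big_seq1 mul1r.
by rewrite big_nil mul0r.
Qed.

Lemma push_inlM_inr (B : nzRingType) (f : series M B) (h : series N B) m :
  (push fibmap_inl f * push fibmap_inr h) m = f m.1 * h m.2.
Proof.
rewrite seriesM big_decomp_pair -{2}[f]mulr1 -{2}[h]mul1r !seriesM.
rewrite mulr_suml; apply: eq_bigr => p _; rewrite mulr_sumr.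
apply: eq_bigr => q _; rewrite push_inl push_inr /= -!mulrA; congr (_ * _).
by rewrite !series1 !mulrA; congr (_ * _); case: eqP; case: eqP;
  rewrite ?mulr1 ?mulr0 ?mul0r.
Qed.

End FibmapInl.

Section FibmapExt.
Variables (M N : gradedNmodType) (e : fibmap N M).

(** Substitutes the variables of [N] by those of [M] along [e] and keeps those of [M]. It will
    identify the third variables of [D] with the first ones ([fibmap_inl]) or the second ones
    ([fibmap_inr]). *)
Let ext_fun (q : M * N) := q.1 + e q.2.
Let ext_fib (m : M) : seq (M * N) :=
  [seq (q.1.1, q.2) | q <- spairs (decomp m) (fun p => fib e p.2)].
Let extD : {morph ext_fun : m n / m + n}.
Proof. by move=> m n; rewrite /ext_fun fibmapD addrACA. Qed.
Let ext_deg m : deg (ext_fun m) = deg m.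
Proof. by rewrite /ext_fun degD fibmap_deg. Qed.
Let ext_uniq m : uniq (ext_fib m).
Proof.
rewrite map_inj_in_uniq; first by apply: spairs_uniq => *; rewrite (fib_uniq, decomp_uniq).
move=> [[a b] k] [[a' b'] k'] + + [-> kk'].
by rewrite !mem_spairs !mem_fib kk' /= => /andP[_ /eqP<-] /andP[_ /eqP<-].
Qed.
Let mem_ext m q : (q \in ext_fib m) = (ext_fun q == m).
Proof.
case: q => a k; apply/mapP/eqP => /= [[[[a' b'] k']]|<-].
  by rewrite mem_spairs mem_decomp mem_fib /= => /andP[/eqP<- /eqP<-] [-> ->].
by exists ((a, e k), k) => //; rewrite mem_spairs mem_decomp mem_fib /= !eqxx.
Qed.
Definition fibmap_ext := Fibmap extD ext_deg ext_uniq mem_ext.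

Lemma push_ext (B : nzRingType) (f : series M B) (h : series N B) :
  push fibmap_ext (fun q => f q.1 * h q.2) = f * push e h.
Proof.
apply/funext => m; rewrite seriesM /push big_map.
rewrite -(big_spairs _ _ _ (fun p k => f p.1 * h k)).
by apply: eq_bigr => p _; rewrite mulr_sumr.
Qed.

End FibmapExt.

(* [D *+ w = X * D] is the differential equation of exp(X) for the grading by
   [w], for which [X] is homogeneous of degree 1. *)
Lemma sexp_weight (K : numFieldType) (M : gradedNmodType) (B : algType K)
    (w : M -> nat) (X D : series M B) :
    (forall m n, w (m + n) = (w m + w n)%N) -> (forall m, w m <= deg m)%N ->
    (forall m, w m != 1%N -> X m = 0) ->
    (forall m, w m = 0%N -> D m = (m == 0)%:R) ->
    (forall m, D m *+ w m = (X * D) m) ->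
  D = sexp X.
Proof.
move=> wD w_deg X1 D0 DX.
(* The divided powers of [X] are the components of [D] by weight; hence only the term [r = w m] of
   the exponential survives at [m]. *)
have dpowE r m : dpow X r m = if w m == r then D m else 0.
  elim: r m => [|r IHr] m.
    rewrite dpow0 series1; have [/D0->//|] := eqVneq (w m) 0%N.
    have [->|//] := eqVneq m 0.
    by have := w_deg 0; rewrite deg0 leqn0 => ->.
  apply: (@mulrn_injS _ _ r); rewrite -seriesMn dpowS seriesM.
  transitivity (\sum_(p <- decomp m)
                  if w m == r.+1 then X p.1 * D p.2 else 0).
    apply: eq_big_seq => p /decompP pm; rewrite IHr -pm wD.
    have [->|/X1->] := eqVneq (w p.1) 1%N; last by rewrite !mul0r if_same.
    by rewrite add1n eqSS; case: ifP => // _; rewrite mulr0.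
  case: eqP => [wm|_]; last by rewrite big1_idem ?mul0rn //= addr0.
  by rewrite -seriesM -DX wm.
apply/funext => m; rewrite /sexp.
have wm : (w m < (deg m).+1)%N by rewrite ltnS.
rewrite (bigD1 (Ordinal wm)) //= dpowE eqxx big1 ?addr0 // => i ne.
by rewrite dpowE; case: eqP => // wi; case/eqP: ne; exact: val_inj.
Qed.

(** * The identity for generating series *)

Section GarlandSeries.
Variables (K : numFieldType) (M : gradedNmodType) (A : comNzRingType) (B : algType K).
Variables xm h xp : {additive A -> B}.
Hypothesis lie_pm : forall a b, xp a * xm b - xm b * xp a = h (a * b).
Hypothesis lie_hp : forall a b, h a * xp b - xp b * h a = xp (a * b) *+ 2.
Hypothesis lie_mh : forall a b, xm a * h b - h b * xm a = xm (a * b) *+ 2.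
Hypothesis comm_p : forall a b, GRing.comm (xp a) (xp b).
Hypothesis comm_m : forall a b, GRing.comm (xm a) (xm b).
Local Notation V := (series M A).
Local Notation W := (series M B).
Implicit Types d f g : V.

Local Notation Xm := (smap xm).
Local Notation H := (smap h).
Local Notation Xp := (smap xp).

Let lieXpm f g : Xp f * Xm g - Xm g * Xp f = H (f * g).
Proof. by rewrite (smap_bracket (z := h) (n := 1%N)) // => a b; rewrite lie_pm. Qed.
Let lieHp f g : H f * Xp g - Xp g * H f = Xp (f * g) *+ 2.
Proof. exact: smap_bracket. Qed.
Let lieXmh f g : Xm f * H g - H g * Xm f = Xm (f * g) *+ 2.
Proof. exact: smap_bracket. Qed.
Let commXp f g : Xp f * Xp g = Xp g * Xp f.
Proof.
apply/eqP; rewrite -subr_eq0 (smap_bracket (z := h) (n := 0%N)) // => a b.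
by rewrite comm_p subrr.
Qed.
Let commXm f g : Xm f * Xm g = Xm g * Xm f.
Proof.
apply/eqP; rewrite -subr_eq0 (smap_bracket (z := h) (n := 0%N)) // => a b.
by rewrite comm_m subrr.
Qed.

(** [x^+ f, x^- g] = h f g and [x^+ f, h f g] = -2 x^+ f^2 g, so [sexp_conj] applies with [W] = -
    x^+ f^2 g. The next two lemmas do the same for exp(x^- f). *)
Lemma conj_sexp_p f g : f 0 = 0 ->
  sexp (Xp f) * Xm g = (Xm g + H (f * g) - Xp (f * f * g)) * sexp (Xp f).
Proof.
move=> f0; apply: sexp_conj.
- by rewrite /smap f0 raddf0.
- exact: lieXpm.
- by rewrite -opprB lieHp mulNrn mulrAC.
- by rewrite mulrN mulNr commXp.
Qed.

Lemma conj_sexp_m f g : f 0 = 0 ->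
  sexp (Xm f) * Xp g = (Xp g - H (g * f) - Xm (f * f * g)) * sexp (Xm f).
Proof.
move=> f0; apply: sexp_conj.
- by rewrite /smap f0 raddf0.
- by rewrite -opprB lieXpm.
- by rewrite mulrN mulNr -opprD lieXmh mulNrn mulrCA mulrC.
- by rewrite mulrN mulNr commXm.
Qed.

Lemma conj_sexp_h f g : f 0 = 0 ->
  sexp (Xm f) * H g = (H g + Xm (f * g) *+ 2) * sexp (Xm f).
Proof.
move=> f0; rewrite -[H g + _]addr0; apply: sexp_conj.
- by rewrite /smap f0 raddf0.
- exact: lieXmh.
- by rewrite mul0rn mulrnAr mulrnAl commXm subrr.
- by rewrite mulr0 mul0r.
Qed.

Definition homog (k : nat) d := forall m, deg m != k -> d m = 0.

Lemma homog_euler k d : homog k d -> euler d = d *+ k.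
Proof.
move=> dk; apply/funext => m; rewrite /euler seriesMn.
by have [->//|/dk->] := eqVneq (deg m) k; rewrite !mul0rn.
Qed.

Lemma homog_ord k d : homog k d -> ord_ge k d.
Proof. by move=> dk m lt_m; rewrite dk // ltn_eqF. Qed.

(* [P] stands for exp(h log(1 + a b)) and [q] for 1/(1 + a b). *)
Section Torus.
Variables (a b q : V).
Hypothesis a1 : homog 1 a.
Hypothesis b1 : homog 1 b.
Hypothesis qE : (1 + a * b) * q = 1.
Variable P : W.
Hypothesis P0 : P 0 = 1.
Hypothesis eulerP : euler P = H (a * b * q *+ 2) * P.

Let a0 : a 0 = 0. Proof. by apply: a1; rewrite deg0. Qed.
Let b0 : b 0 = 0. Proof. by apply: b1; rewrite deg0. Qed.
Let Ea : euler a = a. Proof. by rewrite (homog_euler a1). Qed.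
Let Eb : euler b = b. Proof. by rewrite (homog_euler b1). Qed.

(** Apply [euler] to (1 + a b) q = 1, where E(a b) = 2 a b, and multiply by [q]. *)
Let eulerq : euler q = - (a * b * q * q *+ 2).
Proof.
have := congr1 (@euler _ _) qE; rewrite eulerM eulerD euler1 eulerM Ea Eb add0r.
move=> /(congr1 ( *%R q)); rewrite mulr0 => E0.
have -> : euler q = euler q * ((1 + a * b) * q) by rewrite qE mulr1.
by rewrite -[RHS]add0r -E0; ring.
Qed.

(** Should vanish because exp(h c) x^+ exp(- h c) = e^(2c) x^+, with c = log(1 + a b). *)
Let torus_defect d : W := P * Xp d - Xp (d * (1 + a * b) ^+ 2) * P.

(** Each of the two products satisfies this equation. For u = 1 + a b and c = 2 a b q one has E(d
    u^2) = k d u^2 + 2 c d u^2, and the last term is what [h c, x^+ (d u^2)] contributes when h c is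
    moved to the left. *)
Let euler_defect k d : homog k d ->
  euler (torus_defect d) = H (a * b * q *+ 2) * torus_defect d + torus_defect d *+ k.
Proof.
move=> /homog_euler Ed; set u := 1 + a * b; set c := a * b * q *+ 2.
have Eu : euler u = a * b *+ 2 by rewrite /u eulerD euler1 eulerM Ea Eb add0r.
have Edu : euler (d * u ^+ 2) = d * u ^+ 2 *+ k + c * (d * u ^+ 2) *+ 2.
  rewrite expr2 !eulerM Eu Ed /c.
  have -> : a * b * q *+ 2 * (d * (u * u)) = a * b * d * u * (u * q) *+ 2 by ring.
  by rewrite qE; ring.
have EP : euler P = H c * P by [].
rewrite /torus_defect -/u eulerD eulerN !eulerM !smap_euler Edu Ed EP.
move: (d * u ^+ 2) c {Edu EP} => D c.
have tx : H c * Xp D = Xp (c * D) *+ 2 + Xp D * H c by rewrite -lieHp subrK.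
rewrite !smapD !smapMn mulrBr [H c * (Xp D * P)]mulrA tx !mulrDl mulrnBl.
rewrite !mulrA !mulrnAr !mulrnAl !opprD -!addrA; congr (_ + _).
by rewrite [LHS]addrA [LHS]addrC -!addrA.
Qed.

(** By induction on the degree. In degree [k] both products have the coefficient x^+ d, as [P] and 1
    + a b have constant term 1. In any other degree [euler_defect] determines the coefficient from
    those of lower degree. *)
Let torus_defect0 k d : homog k d -> torus_defect d = 0.
Proof.
move=> dk; apply/funext => m; have [n] := ubnP (deg m).
elim: n m => // n IHn m lt_m; have [mk|mk] := eqVneq (deg m) k.
  rewrite /torus_defect seriesD seriesN (seriesM_leadr (n := k)) //.
    rewrite (seriesM_lead (n := k)) //.
      rewrite P0 mulr1 mul1r /smap (seriesM_lead (n := k)) //; last exact: homog_ord.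
      by rewrite expr2 seriesM0 seriesD seriesM0 a0 mul0r addr0 series1 eqxx !mulr1 subrr.
    rewrite -[k]addn0 => i /(ord_geM (homog_ord dk) (@ord_ge0 _ _ _)) di.
    by rewrite /smap di raddf0.
  by move=> i /(homog_ord dk) di; rewrite /smap di raddf0.
have := congr1 (fun f : W => f m) (euler_defect dk).
rewrite /euler seriesD seriesM seriesMn big_seq big1 ?add0r => [|p /decompP pm].
  (* What is left says that [deg m] times and [k] times the coefficient agree; the smaller multiple
     is cancelled. *)
  have [l|l] := ltnP k (deg m).
    rewrite -(subnK (ltnW l)) mulrnDr -[RHS]add0r => /addIr.
    by rewrite -(subnSK l) -[RHS](mul0rn _ (deg m - k.+1).+1) => /mulrn_injS.
  have {}l : (deg m < k)%N by rewrite ltn_neqAle mk.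
  rewrite -(subnK (ltnW l)) mulrnDr -[LHS]add0r => /addIr /esym.
  by rewrite -(subnSK l) -[RHS](mul0rn _ (k - (deg m).+1).+1) => /mulrn_injS.
have [->|p0] := eqVneq p.1 0.
  by rewrite /smap seriesMn !seriesM0 a0 !mul0r mul0rn raddf0 mul0r.
rewrite IHn ?mulr0 //; move: lt_m; rewrite -pm degD ltnS.
by apply: leq_trans; rewrite -add1n leq_add2r lt0n deg_eq0.
Qed.

(* The coefficient at [m] only involves the homogeneous components of [d] of
   degree at most [deg m], to which [torus_defect0] applies. *)
Lemma torus_conj d : P * Xp d = Xp (d * (1 + a * b) ^+ 2) * P.
Proof.
apply/eqP; rewrite -subr_eq0 -/(torus_defect d); apply/eqP/funext => m.
pose d_ k : V := fun m => if deg m == k then d m else 0.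
pose d' : V := d - \sum_(k < (deg m).+1) d_ k.
have defectD f g : torus_defect (f + g) = torus_defect f + torus_defect g.
  rewrite /torus_defect mulrDl !smapD mulrDr mulrDl opprD.
  by rewrite -!addrA; congr (_ + _); rewrite addrCA.
have -> : d = \sum_(k < (deg m).+1) d_ k + d' by rewrite /d' addrC subrK.
have -> : torus_defect (\sum_(k < (deg m).+1) d_ k + d') = torus_defect d'.
  rewrite defectD [X in X + _](_ : _ = 0) ?add0r //.
  elim/big_ind: _ => [|f g f0 g0|k _].
  - exact: (@torus_defect0 0).
  - by rewrite defectD f0 g0 addr0.
  - apply: (@torus_defect0 k) => i ne; rewrite /d_.
    by rewrite (negPf ne).
have d'm : ord_ge (deg m).+1 d'.
  move=> i lt_i; rewrite /d' seriesD seriesN series_sum (bigD1 (Ordinal lt_i)) //=.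
  rewrite {1}/d_ eqxx big1 ?addr0 ?subrr // => k ne; rewrite /d_.
  by case: eqP => // ik; case/eqP: ne; exact: val_inj.
have smap0 f : ord_ge (deg m).+1 f -> ord_ge (deg m).+1 (Xp f).
  by move=> fm i /fm; rewrite /smap => ->; rewrite raddf0.
rewrite /torus_defect seriesD seriesN.
rewrite (ord_geM (@ord_ge0 _ _ P) (smap0 _ d'm)) ?add0n //.
have d'u : ord_ge (deg m).+1 (d' * (1 + a * b) ^+ 2).
  by rewrite -[_.+1]addn0; apply: ord_geM => //; exact: ord_ge0.
by rewrite (ord_geM (smap0 _ d'u) (@ord_ge0 _ _ P)) ?addn0 // subr0.
Qed.

Theorem garland_series :
  sexp (Xp a) * sexp (Xm b) = sexp (Xm (b * q)) * P * sexp (Xp (a * q)).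
Proof.
have smap0 (x : {additive A -> B}) f : f 0 = 0 -> smap x f 0 = 0.
  by move=> f0; rewrite /smap f0 raddf0.
have sexpE (x : {additive A -> B}) f : f 0 = 0 ->
    (forall f g, smap x f * smap x g = smap x g * smap x f) ->
    euler (sexp (smap x f)) = smap x (euler f) * sexp (smap x f).
  by move=> f0 xC; rewrite sexp_euler ?smap0 // smap_euler // xC.
have bq0 : (b * q) 0 = 0 by rewrite seriesM0 b0 mul0r.
have aq0 : (a * q) 0 = 0 by rewrite seriesM0 a0 mul0r.
pose Y : W := Xp a + Xm b + H (a * b) - Xp (a * a * b).
(* Here E a = a and E b = b, and x^- b is moved to the left of exp(x^+ a). *)
have EL : euler (sexp (Xp a) * sexp (Xm b)) = Y * (sexp (Xp a) * sexp (Xm b)).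
  rewrite eulerM !sexpE // Ea Eb mulrA conj_sexp_p // -!mulrA -mulrDl /Y !addrA.
  by rewrite [a * (a * b)]mulrA.
have ER : euler (sexp (Xm (b * q)) * P * sexp (Xp (a * q))) =
    Y * (sexp (Xm (b * q)) * P * sexp (Xp (a * q))).
  (* The argument of x^+ E(a q) after it is moved to the left of [P]; it has no [q] any more, as (1
     + a b) q = 1. *)
  have Eaq : euler (a * q) * (1 + a * b) ^+ 2 = a - a * a * b.
    rewrite eulerM Ea eulerq.
    transitivity (a * (1 + a * b) * ((1 + a * b) * q)
        - a * a * b * (((1 + a * b) * q) * ((1 + a * b) * q)) *+ 2); first by ring.
    by rewrite qE; ring.
  have GpE : P * Xp (euler (a * q)) = Xp (a - a * a * b) * P.
    by rewrite torus_conj Eaq.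
  have GmH := conj_sexp_h (a * b * q *+ 2) bq0.
  have GmP := conj_sexp_m (a - a * a * b) bq0.
  (* The three groups come from differentiating exp(x^- b q), [P] and exp(x^+ a q), each moved to
     the far left by [GmH], [GpE] and [GmP]. *)
  have YE : Y = Xm (euler (b * q)) + (H (a * b * q *+ 2)
      + Xm (b * q * (a * b * q *+ 2)) *+ 2) + (Xp (a - a * a * b)
      - H ((a - a * a * b) * (b * q)) - Xm (b * q * (b * q) * (a - a * a * b))).
    have Hab : H (a * b) = H (a * b * q *+ 2) - H ((a - a * a * b) * (b * q)).
      rewrite -smapN -smapD; congr (smap _ _).
      transitivity (a * b * ((1 + a * b) * q)); first by rewrite qE mulr1.
      by ring.
    have Xmb : Xm b = Xm (euler (b * q)) + Xm (b * q * (a * b * q *+ 2)) *+ 2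
        - Xm (b * q * (b * q) * (a - a * a * b)).
      rewrite -smapMn -smapN -!smapD; congr (smap _ _); rewrite eulerM Eb eulerq.
      transitivity (b * ((1 + a * b) * q)
         + a * b * b * q * ((1 + a * b) * q) - a * b * b * q); last by ring.
      by rewrite qE; ring.
    rewrite /Y Hab Xmb smapD smapN.
    by rewrite [LHS](AC ((1*3)*2*1) (2*(5*3)*(((1*7)*6)*4)))%AC.
  rewrite !eulerM !sexpE // eulerP {}YE.
  move: GmH GmP; move: (_ - Xm _) (_ + Xm _ *+ 2) (Xm (euler (b * q))).
  move: (sexp (Xm (b * q))) (sexp (Xp (a * q))) => Gm Gp y k e GmH GmP.
  rewrite !mulrDl; congr (_ + _ + _); rewrite !mulrA //.
    by rewrite -GmH.
  by rewrite -GmP -(mulrA Gm) GpE !mulrA.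
apply/eqP; rewrite -subr_eq0; apply/eqP; apply: (euler_unique (Y := Y)).
- by rewrite /Y !seriesD seriesN !smap0 ?seriesM0 ?a0 ?b0 ?mul0r ?mulr0 // subr0 !addr0.
- by rewrite seriesD seriesN !seriesM0 !sexp0 ?smap0 // P0 !mulr1 subrr.
- by rewrite eulerD eulerN EL ER mulrBr.
Qed.

End Torus.
End GarlandSeries.

Lemma push_homog (M N : gradedNmodType) (A : comNzRingType) (g : fibmap M N) k
  (f : series M A) : homog k f -> homog k (push g f).
Proof.
move=> fk n nk; rewrite /push big_seq big1 // => m; rewrite mem_fib => /eqP gm.
by apply: fk; rewrite -(fibmap_deg g) gm.
Qed.

(** * The generating series of p, D and the divided powers *)

Section InverseSeries.
Variables (N : gradedNmodType) (A : comNzRingType) (v mu : series N A).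
Hypothesis v1 : homog 1 v.
Hypothesis muE : mu = 1 + v * mu.

(* With s = v(first variables), t = v(second variables) and mu = 1/(1 - v), the
   diagonal part of 1/((1 - s)(1 + t)) is 1/(1 + s t). *)
Definition diag_series : series (N * N)%type A :=
  fun m => if deg m.1 == deg m.2 then (-1) ^+ deg m.2 * (mu m.1 * mu m.2) else 0.

(** Multiplication by s t replaces [mu] by v mu = mu - 1 in both factors and, raising both degrees
    by one, changes the sign. So the two terms cancel except at 0. *)
Lemma diag_seriesE :
  (1 + push (fibmap_inl N N) v * push (fibmap_inr N N) v) * diag_series = 1.
Proof.
have vmu m : (v * mu) m = mu m - (m == 0)%:R.
  by rewrite {2}muE seriesD series1 addrC addKr.
rewrite mulrDl mul1r; apply/funext => m; rewrite seriesD series1.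
have -> : (push (fibmap_inl N N) v * push (fibmap_inr N N) v * diag_series) m =
    if deg m.1 == deg m.2 then - ((-1) ^+ deg m.2 * ((v * mu) m.1 * (v * mu) m.2))
    else 0.
  rewrite seriesM big_decomp_pair.
  transitivity (\sum_(p <- decomp m.1) \sum_(r <- decomp m.2)
    if deg m.1 == deg m.2 then
      - ((-1) ^+ deg m.2 * ((v p.1 * mu p.2) * (v r.1 * mu r.2))) else 0).
    apply: eq_big_seq => p /decompP pm; apply: eq_big_seq => r /decompP rm.
    rewrite push_inlM_inr /diag_series /= -pm -rm !degD.
    have [d1|/v1->] := eqVneq (deg p.1) 1%N; last first.
      by rewrite !(mul0r, mulr0) oppr0 if_same.
    have [d2|/v1->] := eqVneq (deg r.1) 1%N; last first.
      by rewrite !(mul0r, mulr0) oppr0 if_same.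
    rewrite d1 d2 !add1n eqSS; case: ifP => _; last by rewrite mulr0.
    by rewrite exprS; ring.
  case: ifP => _; last by rewrite big1 // => p _; rewrite big1.
  rewrite !seriesM mulr_suml mulr_sumr -sumrN; apply: eq_bigr => p _.
  by rewrite !mulr_sumr -sumrN.
rewrite /diag_series !vmu; case: m => m n /=.
rewrite -[(m, n) == 0]/((m == 0) && (n == 0)).
have mu0 : mu 0 = 1.
  by rewrite muE seriesD series1 eqxx seriesM0 v1 ?mul0r ?addr0 // deg0.
case: eqP => [mn|ne]; last first.
  by rewrite addr0; do 2!case: eqP => //= ?; case: ne; subst.
have : (m == 0) = (n == 0) by rewrite -!deg_eq0 mn.
have [->|_] := eqVneq m 0 => /esym; last first.
  by move=> ->; rewrite !subr0 subrr.
by move=> /eqP->; rewrite eqxx mu0 deg0 expr0 subrr mulr1 mulr0 mulr0 oppr0 addr0 mulr1.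
Qed.

End InverseSeries.

Section MultisetSeries.
Variables (K : numFieldType) (A : comAlgType K).
Local Notation F := {mset A}.
Local Notation U := (enveloping (sl2_tensor A)).
Implicit Types (m n psi phi chi xi : F).
Local Notation mset_prod := (@mset_prod K A).
Local Notation multinomial := (@multinomial K A).

Lemma mset_size1 psi : size psi = 1%N -> exists b, psi = [mset b]%mset.
Proof.
case E : (enum_mset psi) => [|b []] // _; exists b.
by rewrite -[psi]seq_mset_id E; apply/msetP => a; rewrite mset_seqE msetnE /= addn0 eq_sym; case: eqP.
Qed.

Lemma sum_decomp1 (V : nmodType) m (G : F * F -> V) :
  \sum_(p <- decomp m | deg p.1 == 1%N) G p =
  \sum_(b <- finsupp m) G ([mset b], m `\ b)%mset.
Proof.
rewrite -big_filter.
rewrite -(big_map (fun b => ([mset b], m `\ b)%mset) predT G).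
apply: perm_big; apply: uniq_perm; first exact/filter_uniq/decomp_uniq.
  rewrite map_inj_uniq ?fset_uniq // => a b [] /msetP/(_ a).
  by rewrite !msetnE eqxx; case: eqP.
move=> [u v]; rewrite mem_filter /=; apply/andP/mapP => [[/eqP/mset_size1[b ->]]|].
  move=> /decompP /= <-; exists b; first by rewrite msuppE mset1D1.
  by rewrite -[_ + v]/([mset b] `+` v)%mset msetD1K.
move=> [b]; rewrite msuppE => bm [-> ->]; rewrite deg_mset enum_msetn; split => //.
by apply/decompP; rewrite /= -[LHS]/(b +` (m `\ b))%mset msetB1K.
Qed.

Lemma sum_submsets0 (V : nmodType) m (G : F -> V) :
  \sum_(psi \in submsets m `\ mset0) G psi =
  \sum_(p <- decomp m) if p.1 == 0 then 0 else G p.1.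
Proof.
rewrite setDE fsbig_mkcondr sum_submsets; apply: eq_bigr => p _.
have -> : (p.1 \in ~` [set mset0]) = (p.1 != 0).
  by apply/idP/idP => [/set_mem/eqP|/eqP ?]; last exact/mem_set.
by case: eqP.
Qed.

Lemma mset_prodD psi phi : mset_prod (psi + phi) = mset_prod psi * mset_prod phi.
Proof.
have prodE xi : mset_prod xi = \prod_(a <- xi) a by rewrite big_mset.
rewrite !prodE -big_cat; apply: perm_big; apply/allP => a _ /=.
by rewrite count_cat !count_mem_mset msetE2.
Qed.

Lemma mset_prod1 b : mset_prod [mset b]%mset = b.
Proof. by rewrite /mset_prod finsupp_msetn big_seq_fset1 msetnxx expr1. Qed.

Definition mset_fact psi : nat := \prod_(a <- finsupp psi) (psi a)`!.

Lemma mset_factB psi b : b \in psi -> mset_fact psi = (psi b * mset_fact (psi `\ b)%mset)%N.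
Proof.
move=> b_psi; rewrite /mset_fact [in RHS](@big_fset_incl _ _ _ _ _ (finsupp psi)).
- rewrite !(bigD1_seq b (r := finsupp psi)) ?fset_uniq ?msuppE //=.
  rewrite mulnA msetB1E eqxx subn1.
  have : (0 < psi b)%N by rewrite mset_gt0.
  case: (psi b) => // k _; rewrite factS; congr (_ * _)%N.
  by apply: eq_bigr => a /negPf ne; rewrite msetB1E ne subn0.
- by apply/fsubsetP => a; rewrite !msuppE in_msetB1 => /andP[].
- by move=> a _; rewrite msuppE => /mset_eq0P->.
Qed.

Lemma size_mset_sum psi : size psi = (\sum_(b <- finsupp psi) psi b)%N.
Proof. by rewrite -sum1_size sum_mset; apply: eq_bigr => b _; rewrite muln1. Qed.

(* The series sum_a t_a a and 1/(1 - sum_a t_a a). *)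
Definition mset_letter : series F A :=
  fun psi => if size psi == 1%N then mset_prod psi else 0.
Definition mset_geom : series F A := fun psi => multinomial psi *: mset_prod psi.

Lemma mset_letter1 : homog 1 mset_letter.
Proof. by move=> m /negPf m1; rewrite /mset_letter m1. Qed.

(** Only the decompositions that split off a single element survive, since [mset_letter] is 0
    elsewhere. *)
Lemma sum_letter (V : nmodType) (G : A -> F -> V) m : (forall n, G 0 n = 0) ->
  \sum_(p <- decomp m) G (mset_letter p.1) p.2 =
  \sum_(b <- finsupp m) G b (m `\ b)%mset.
Proof.
move=> G0; rewrite (bigID (fun p => deg p.1 == 1%N)) /= [X in _ + X]big1 ?addr0.
  rewrite (sum_decomp1 m (fun p => G (mset_letter p.1) p.2)).
  by apply: eq_bigr => b _; rewrite /mset_letter enum_msetn mset_prod1.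
by move=> p /mset_letter1->.
Qed.

Lemma letterM (B : nzRingType) (x : {additive A -> B}) (G : series F B) m :
  (smap x mset_letter * G) m = \sum_(b <- finsupp m) x b * G (m `\ b)%mset.
Proof.
by rewrite seriesM (sum_letter (G := fun a n => x a * G n)) // => n;
  rewrite raddf0 mul0r.
Qed.

Lemma addmB psi phi : (((psi + phi)%R : F) `\` psi)%mset = phi.
Proof. exact: msetDKB. Qed.

(** Recursion of the multinomial coefficients by the first letter of a word: those with first letter
    [b] number (|m| - 1)! m(b) / prod_a m(a)!, and the m(b) add up to |m|. *)
Lemma mset_geomE : mset_geom = 1 + mset_letter * mset_geom.
Proof.
have idE : mset_letter = smap (idfun : {additive A -> A}) mset_letter by [].
apply/funext => m; rewrite seriesD series1 [in RHS]idE letterM /mset_geom.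
have [->|m0] := eqVneq m 0.
  rewrite [finsupp _]finsupp0 big_seq_fset0 addr0 /multinomial /mset_prod.
  by rewrite !finsupp0 !big_seq_fset0 size_mset0 fact0 divr1 scale1r.
rewrite add0r (eq_big_seq (fun b =>
   ((size m).-1`!%:R * (m b)%:R / (mset_fact m)%:R) *: mset_prod m)).
  rewrite -scaler_suml -mulr_suml -mulr_sumr -natr_sum -size_mset_sum -natrM mulnC.
  have m_gt0 : (0 < size m)%N by rewrite lt0n size_mset_eq0.
  by rewrite /multinomial -{1}(prednK m_gt0) factS prednK.
move=> b; rewrite msuppE => bm.
have bmE : mset_prod m = b * mset_prod (m `\ b)%mset.
  rewrite -{1}(mset_prod1 b) -mset_prodD; congr (mset_prod _).
  by rewrite -[RHS]/(b +` (m `\ b))%mset msetB1K.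
rewrite bmE -scalerAr; congr (_ *: _).
rewrite /multinomial size_msetB ?msub1set // enum_msetn subn1 -/(mset_fact _).
rewrite (mset_factB bm) natrM invfM mulrA -!mulrA; congr (_ * _).
by rewrite mulVKf // pnatr_eq0 mset_eq0 negbK.
Qed.

Lemma perm_prod_comm (R : nzRingType) (I : eqType) (s t : seq I) (G : I -> R) :
  (forall i j, GRing.comm (G i) (G j)) -> perm_eq s t ->
  \prod_(i <- s) G i = \prod_(i <- t) G i.
Proof.
move=> Gc st; apply: (catCA_perm_ind (P := fun t => \prod_(i <- s) G i = \prod_(i <- t) G i) _ st) => // s1 s2 s3 ->.
rewrite !big_cat /= !mulrA; congr (_ * _).
have comm_prod i r : GRing.comm (G i) (\prod_(j <- r) G j).
  by apply: (big_ind (GRing.comm (G i))) => //; [exact: commr1 | exact: commrM].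
elim: s1 => [|i s1 IH]; first by rewrite big_nil mul1r mulr1.
by rewrite !big_cons -mulrA IH mulrA comm_prod mulrA.
Qed.

(** * Products of divided powers as coefficients of an exponential *)

Section XProd.
Variable x : {additive A -> U}.
Hypothesis x_comm : forall a b, GRing.comm (x a) (x b).

Lemma divpowS (u : U) r : divpow u r.+1 *+ r.+1 = u * divpow u r.
Proof.
rewrite /divpow -scalerAr -exprS scalerMnl -mulr_natr factS natrM invfM.
by rewrite mulrAC mulVf ?mul1r // pnatr_eq0.
Qed.

Lemma comm_divpow (u v : U) j : GRing.comm u v -> GRing.comm u (divpow v j).
Proof. by move=> uv; rewrite /divpow /GRing.comm -scalerAl -scalerAr (commrX j uv). Qed.

Lemma xprodB psi b : b \in psi ->
  xprod x psi *+ psi b = x b * xprod x (psi `\ b)%mset.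
Proof.
move=> b_psi.
(* Lets both products run over the support of [psi]: if [b] has left the support, its factor is the
   divided power 0, which is 1. Commutation is needed since the two supports may be enumerated in
   different orders. *)
have -> : xprod x (psi `\ b)%mset =
    \prod_(a <- finsupp psi) divpow (x a) ((psi `\ b)%mset a).
  rewrite [RHS](eq_bigr (fun a => if a \in (psi `\ b)%mset
      then divpow (x a) ((psi `\ b)%mset a) else 1)) => [|a _]; last first.
    by case: ifPn => // /mset_eq0P->; rewrite /divpow fact0 invr1 scale1r.
  rewrite -big_mkcond -big_filter; apply: perm_prod_comm => [a c|].
    by apply/comm_divpow/commr_sym/comm_divpow.
  apply: uniq_perm; rewrite ?filter_uniq ?fset_uniq // => a.
  rewrite mem_filter !msuppE in_msetB1.
  by case: (a \in psi); rewrite ?andbT ?andbF.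
have [k bk] : exists k, psi b = k.+1.
  by move: b_psi; rewrite -mset_neq0; case: (psi b) => // k; exists k.
rewrite /xprod; move: b_psi (fset_uniq (finsupp psi)); rewrite -msuppE.
rewrite -[b \in finsupp psi]/(b \in (finsupp psi : seq A)).
elim: (finsupp psi : seq A) => // a s IHs; rewrite inE !big_cons /=.
have [->|ab] := eqVneq a b.
  move=> _ /andP[bs _]; rewrite msetB1E eqxx bk subn1 /= mulrA -divpowS mulrnAl.
  congr (_ * _ *+ _); apply: eq_big_seq => c cs; rewrite msetB1E.
  by case: eqP => [cb|]; rewrite ?subn0 //; rewrite -cb cs in bs.
move=> /= bs /andP[_ us]; rewrite msetB1E (negPf ab) subn0.
by rewrite -mulrnAr IHs // [LHS]mulrA [RHS]mulrA (comm_divpow _ (x_comm b a)).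
Qed.

(** The sum of [xprodB] over [b] is the equation of [sexp_weight], with the degree as weight. *)
Lemma xprod_series : xprod x = sexp (smap x mset_letter).
Proof.
apply: (sexp_weight (w := @deg _)) => //.
- exact: degD.
- by move=> m m1; rewrite /smap mset_letter1 // raddf0.
- move=> m /eqP; rewrite deg_eq0 => /eqP->; rewrite eqxx.
  by rewrite /xprod finsupp0 big_seq_fset0.
- move=> m; rewrite letterM deg_mset size_mset_sum -sumrMnr.
  by apply: eq_big_seq => b; rewrite msuppE => /xprodB.
Qed.
End XProd.

(** * The generating series of [D] *)

Section DSeries.
Variable x : {linear A -> U}.

Definition q_series := diag_series mset_geom.

(* The sign substitutes [-t_a] for the second variables, so that [1/(1 - st)]
   becomes [q_series]. *)
Definition D_series : series (F * F * F)%type U :=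
  fun t => (-1) ^+ size t.1.2 * D x t.1.1 t.1.2 t.2.

Lemma D_mset1_series phi psi b :
  (-1) ^+ size psi * D x phi psi [mset b]%mset = x (q_series (phi, psi) * b).
Proof.
rewrite D_mset1 /q_series /diag_series /=.
case: eqP => _; last by rewrite !mul0r mulr0 raddf0.
rewrite mul1r deg_mset -[_ * _ * b]mulrA raddfMsign; congr (_ * _).
rewrite -linearZ; congr (x _).
by rewrite /mset_geom -scalerAl -scalerAr scalerA -scalerAl [b * _]mulrC.
Qed.

(** The recursion without division, in a form that holds for every size of [xi], as [sexp_weight]
    requires. *)
Lemma D_rec1 phi psi xi : D x phi psi xi *+ size xi =
  \sum_(p <- decomp phi) \sum_(r <- decomp psi) \sum_(b <- finsupp xi)
    D x p.1 r.1 [mset b]%mset * D x p.2 r.2 (xi `\ b)%mset.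
Proof.
have [xi2|] := leqP 2 (size xi).
  rewrite D_ge2 // -scaler_nat scalerA divff ?scale1r; last first.
    by rewrite pnatr_eq0 -lt0n (leq_trans _ xi2).
  rewrite sum_submsets; apply: eq_big_seq => p /decompP <-.
  rewrite sum_submsets; apply: eq_big_seq => r /decompP <-.
  by rewrite !addmB.
case E : (size xi) => [|[|]] // _.
  move/eqP: E; rewrite size_mset_eq0 => /eqP->; rewrite mulr0n big1 // => p _.
  by rewrite big1 // => r _; rewrite finsupp0 big_seq_fset0.
have [b ->] := mset_size1 E; rewrite mulr1n.
(* For a singleton the second factors are [D] at the empty multiset, the coefficients of 1, so the
   sum is a coefficient of [f * 1]. *)
pose f : series (F * F)%type U := fun t => D x t.1 t.2 [mset b]%mset.
transitivity ((f * 1) (phi, psi)); first by rewrite mulr1.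
rewrite seriesM big_decomp_pair; apply: eq_bigr => p _; apply: eq_bigr => r _.
rewrite finsupp_msetn big_seq_fset1 series1 -deg_eq0 deg_pair /= !deg_mset.
have -> : ([mset b] `\ b)%mset = mset0 by apply/msetP => c; rewrite msetB1E msetnE mset0E; case: eqP.
by rewrite D_mset0.
Qed.

(** [sexp_weight] for the degree in the third variables alone, in which the exponent is linear. *)
Lemma D_seriesE :
  D_series = sexp (smap x (fun t => q_series t.1 * mset_letter t.2)).
Proof.
apply: (sexp_weight (w := fun t => deg t.2)).
- by move=> s t; rewrite degD.
- by move=> t; rewrite deg_pair leq_addl.
- by move=> t t1; rewrite /smap mset_letter1 // mulr0 raddf0.
- move=> [[phi psi] xi] /= /eqP; rewrite deg_eq0 => /eqP->.
  rewrite /D_series /= D_mset0 -deg_eq0 !deg_pair /= deg0 addn0 !deg_mset.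
  by case: (size (psi : F)) => [|k]; rewrite ?mul1r // addnS mulr0.
- move=> [[phi psi] xi] /=; rewrite /D_series /= -mulrnAr D_rec1 seriesM.
  rewrite !big_decomp_pair /= mulr_sumr; apply: eq_bigr => p _.
  rewrite mulr_sumr; apply: eq_big_seq => r /decompP <-.
  rewrite (sum_letter (G := fun a n => x (q_series (p.1, r.1) * a) *
     ((-1) ^+ size (r.2 : F) * D x p.2 r.2 n))) => [|n]; last by rewrite mulr0 raddf0 mul0r.
  rewrite mulr_sumr; apply: eq_bigr => b _.
  rewrite -D_mset1_series -!deg_mset degD exprD.
  rewrite -!mulrA; congr (_ * _); rewrite !mulrA; congr (_ * _).
  exact/esym/commr_sign.
Qed.

End DSeries.

(** * The relations of sl_2 (x) A in its enveloping algebra *)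

Lemma ugen_tens_linear (z : sl2 K) : linear (fun a : A => ugen (tens z a) : U).
Proof. by move=> k a b; rewrite tens_linearr linearP. Qed.

HB.instance Definition _ :=
  GRing.isLinear.Build K A U *:%R (@xm K A) (ugen_tens_linear xminus).
HB.instance Definition _ :=
  GRing.isLinear.Build K A U *:%R (@xp K A) (ugen_tens_linear xplus).
HB.instance Definition _ :=
  GRing.isLinear.Build K A U *:%R (@hh K A) (ugen_tens_linear hsl2).

Lemma tensZ (z : sl2 K) (a : A) k : tens (k *: z) a = k *: tens z a.
Proof.
have tens0 : tens 0 a = 0 by apply: sl2_tensor_ext; exact: scale0r.
by rewrite -[_ *: z]addr0 tens_linearl tens0 addr0.
Qed.

Lemma lie_xp_xm (a b : A) : xp a * xm b - xm b * xp a = hh (a * b) :> U.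
Proof. by rewrite -ugen_lie lie_tens lie_xplus_xminus. Qed.

Lemma lie_hh_xp (a b : A) : hh a * xp b - xp b * hh a = xp (a * b) *+ 2 :> U.
Proof. by rewrite -ugen_lie lie_tens lie_h_xplus tensZ linearZ /= scaler_nat. Qed.

Lemma lie_xm_hh (a b : A) : xm a * hh b - hh b * xm a = xm (a * b) *+ 2 :> U.
Proof.
rewrite -opprB -ugen_lie lie_tens lie_h_xminus -scaleNr tensZ linearZ /= scaleNr.
by rewrite opprK scaler_nat [b * a]mulrC.
Qed.

(** * The generating series of [p] *)

Definition p_series : series (F * F)%type U :=
  fun t => (-1) ^+ size t.2 * p t.1 t.2.

Lemma p_series0 : p_series 0 = 1.
Proof. by rewrite /p_series /= p00 size_mset0 mulr1. Qed.

(** The first case matches the recursion of [p], which leaves out the empty multiset in both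
    sums. *)
Lemma one_sub_q psi phi : (1 - q_series) (psi, phi) =
  if (psi == 0) || (phi == 0) then 0 else
  if size psi == size phi then - ((-1) ^+ size phi * (mset_geom psi * mset_geom phi))
  else 0.
Proof.
rewrite seriesD seriesN series1 -[(psi, phi) == 0]/((psi == 0) && (phi == 0)).
rewrite /q_series /diag_series /= !deg_mset.
have geom0 : mset_geom 0 = 1 :> A.
  by rewrite mset_geomE seriesD series1 eqxx seriesM0 mset_letter1 ?deg0 // mul0r addr0.
have [->|psi0] := eqVneq psi 0; have [->|phi0] := eqVneq phi 0 => /=.
- by rewrite eqxx size_mset0 geom0 !mulr1 subrr.
- by rewrite size_mset0 eq_sym size_mset_eq0 (negPf phi0) subr0.
- by rewrite size_mset0 size_mset_eq0 (negPf psi0) subr0.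
- by case: ifP => _; rewrite ?subr0 // sub0r.
Qed.

(** The recursion of [p] read as E P = h (E log(1 + alpha beta)) P, where E log(1 + alpha beta) = 2
    (1 - q). The factor 2 appears because the total degree of a nonzero term is twice the size of
    [phi]. *)
Lemma p_series_euler : euler p_series = smap hh ((1 - q_series) *+ 2) * p_series.
Proof.
apply/funext => -[]; change (forall phi chi : F, euler p_series (phi, chi) =
  (smap hh ((1 - q_series) *+ 2) * p_series) (phi, chi)) => phi chi.
rewrite smapMn mulrnAl seriesMn /euler deg_pair !deg_mset /=.
rewrite seriesM big_decomp_pair /=.
have [phichi|ne] := eqVneq (size phi) (size chi); last first.
  rewrite [X in X *+ _ = _]/p_series /= p_neq_size ?mulr0 ?mul0rn; last exact/eqP.
  rewrite big_seq big1 ?mul0rn // => t /decompP tE.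
  rewrite big_seq big1 // => r /decompP rE; rewrite /p_series /=.
  have [e2|ne2] := eqVneq (size (t.2 : F)) (size (r.2 : F)); last first.
    by rewrite p_neq_size ?mulr0 //; exact/eqP.
  have ne1 : size (t.1 : F) != size (r.1 : F).
    by apply: contraNneq ne => e1; rewrite -tE -rE -!deg_mset !degD !deg_mset e1 e2.
  by rewrite /smap one_sub_q (negPf ne1) if_same raddf0 mul0r.
rewrite phichi addnn -mul2n mulnC mulrnA; congr (_ *+ 2).
transitivity (- ((-1) ^+ size chi * \sum_(t <- decomp phi) \sum_(r <- decomp chi)
    if (t.1 == 0) || (r.1 == 0) then 0 else
    (multinomial t.1 * multinomial r.1) *:
      (hh (mset_prod t.1 * mset_prod r.1) * p t.2 r.2)) : U); last first.
  rewrite mulr_sumr -sumrN; apply: eq_big_seq => t /decompP tE.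
  rewrite mulr_sumr -sumrN; apply: eq_big_seq => r /decompP rE.
  rewrite /smap one_sub_q; case: ifP => _; first by rewrite raddf0 mulr0 mul0r oppr0.
  case: eqP => [e1|ne1]; last first.
    rewrite raddf0 mul0r p_neq_size ?mulr0 ?scaler0 ?mulr0 ?oppr0 // => e2; case: ne1.
    move: phichi; rewrite -tE -rE -!deg_mset !degD !deg_mset e2.
    exact: addIn.
  have hE : hh ((-1) ^+ size (r.1 : F) * (mset_geom t.1 * mset_geom r.1)) =
      (-1) ^+ size (r.1 : F) * ((multinomial t.1 * multinomial r.1) *:
      hh (mset_prod t.1 * mset_prod r.1)) :> U.
    rewrite raddfMsign; congr (_ * _); rewrite -linearZ; congr (hh _).
    by rewrite /mset_geom -scalerAl -scalerAr scalerA.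
  rewrite raddfN /= hE /p_series /= scalerAl -rE -deg_mset degD !deg_mset exprD.
  move: (_ *: hh _) (p _ _) => u v.
  rewrite mulNr; congr (- _).
  rewrite -!mulrA; congr (_ * _); rewrite !mulrA; congr (_ * _).
  exact/esym/commr_sign.
have [phi0|phi0] := eqVneq phi 0.
  rewrite -phichi phi0 size_mset0 mulr0n big_seq big1 ?mulr0 ?oppr0 // => t.
  rewrite mem_decomp addr_eq0_graded => /andP[-> _].
  by rewrite big1.
have chi0 : chi != 0 by rewrite -size_mset_eq0 -phichi size_mset_eq0.
rewrite /p_series /= p_neq0 //; try exact/eqP.
rewrite -mulrnAr -mulrN; congr (_ * _).
rewrite scaleNr mulNrn; congr (- _).
rewrite -scaler_nat scalerA phichi divff ?scale1r; last first.
  by rewrite pnatr_eq0 size_mset_eq0.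
rewrite sum_submsets0; apply: eq_big_seq => t /decompP <-.
case: eqP => _; first by rewrite big1.
rewrite sum_submsets0; apply: eq_big_seq => r /decompP <-.
by rewrite !addmB.
Qed.

Definition p_series_ext : series (F * F * F)%type U :=
  fun t => p_series t.1 * (1 : series F U) t.2.

Lemma bbD_series phi psi xi :
  (-1) ^+ size psi * bbD phi psi xi =
  (p_series_ext * D_series xp) ((phi, psi), xi).
Proof.
rewrite seriesM !big_decomp_pair /= /bbD sum_submsets mulr_sumr.
apply: eq_big_seq => t /decompP <-; rewrite sum_submsets mulr_sumr.
apply: eq_big_seq => r /decompP <-; rewrite /= !addmB.
pose G : series F U := fun xi => D_series xp (t.2, r.2, xi).
transitivity (p_series (t.1, r.1) * (1 * G) xi); last first.
  by rewrite seriesM mulr_sumr; apply: eq_bigr => s _; rewrite mulrA.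
rewrite mul1r /p_series /G /D_series /= -!deg_mset degD exprD.
rewrite -!mulrA; congr (_ * _); rewrite !mulrA; congr (_ * _).
exact/esym/commr_sign.
Qed.

(** * Comparison of coefficients *)

Lemma msetBB psi phi xi : ((psi + xi + phi)%R `\` psi `\` phi)%mset = xi.
Proof. by apply/msetP => a; rewrite !msetE2; lia. Qed.

Lemma msetBBK psi phi xi : (psi `+` phi `<=` xi)%mset ->
  (psi + (xi `\` psi `\` phi)%mset + phi)%R = xi.
Proof.
move=> /msubsetP le; apply/msetP => a; have := le a.
by rewrite !msetE2; lia.
Qed.

Theorem garland_formula phi chi :
  xprod xp phi * xprod xm chi =
  \sum_(q \in [set q : F * F * F * F |
                 let: (psi1, psi2, phi1, phi2) := q in
                 submsets chi (psi1 `+` psi2)%mset /\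
                 submsets phi (phi1 `+` phi2)%mset])
    let: (psi1, psi2, phi1, phi2) := q : F * F * F * F in
    (-1) ^+ (size psi1 + size psi2) *
    D xm phi1 psi1 (chi `\` psi1 `\` psi2)%mset *
    bbD phi2 psi2 (phi `\` phi1 `\` phi2)%mset.
Proof.
pose inl := fibmap_inl F F; pose inr := fibmap_inr F F.
pose a := push inl mset_letter; pose b := push inr mset_letter.
have a1 : homog 1 a by apply: push_homog; exact: mset_letter1.
have b1 : homog 1 b by apply: push_homog; exact: mset_letter1.
have qE : (1 + a * b) * q_series = 1.
  by apply: diag_seriesE; [exact: mset_letter1 | exact: mset_geomE].
have eP : euler p_series = smap hh (a * b * q_series *+ 2) * p_series.
  by rewrite p_series_euler -{1}qE mulrDl mul1r addrC addKr.
have X_inl : sexp (smap xp a) = push inl (xprod xp).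
  by rewrite /a -push_smap -push_sexp -xprod_series //; exact: ugen_tens_comm.
have X_inr : sexp (smap xm b) = push inr (xprod xm).
  by rewrite /b -push_smap -push_sexp -xprod_series //; exact: ugen_tens_comm.
(* The third variables become the t_a for D^- and the s_a for D^+, which turns the exponents into
   x^- beta q and x^+ alpha q. *)
have D_m : sexp (smap xm (b * q_series)) = push (fibmap_ext inr) (D_series xm).
  by rewrite D_seriesE push_sexp push_smap push_ext mulrC.
have D_p : sexp (smap xp (a * q_series)) = push (fibmap_ext inl) (D_series xp).
  by rewrite D_seriesE push_sexp push_smap push_ext mulrC.
have PE : p_series = push (fibmap_ext inl) p_series_ext.
  by rewrite push_ext push1 mulr1.
have main : push inl (xprod xp) * push inr (xprod xm) =
    push (fibmap_ext inr) (D_series xm) *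
    push (fibmap_ext inl) (p_series_ext * D_series xp).
  rewrite pushM.
  rewrite -PE.
  rewrite mulrA.
  rewrite -X_inl.
  rewrite -X_inr.
  rewrite -D_m.
  rewrite -D_p.
  exact: (garland_series lie_xp_xm lie_hh_xp lie_xm_hh (ugen_tens_comm xplus)
    (ugen_tens_comm xminus) a1 b1 qE p_series0 eP).
move/(congr1 (fun f : series _ U => f (phi, chi))): main.
rewrite push_inlM_inr.
move=> ->; rewrite seriesM fsbig_finite /=; last exact: finite_submsets4.
move: (p_series_ext * _) (bbD_series) => G GE.
pose gm := fibmap_ext inr; pose gp := fibmap_ext inl.
transitivity (\sum_(t <- decomp (phi, chi))
   \sum_(kl <- spairs (fib gm t.1) (fun=> fib gp t.2)) D_series xm kl.1 * G kl.2).
  apply: eq_bigr => t _; rewrite -(big_spairs _ _ _ (fun k l => D_series xm k * G l)).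
  by rewrite mulr_suml; apply: eq_bigr => k _; rewrite mulr_sumr.
(* A term is given by ((phi1, psi1), xi) and ((phi2, psi2), zeta) with phi1 + zeta + phi2 = phi and
   psi1 + xi + psi2 = chi. So xi and zeta are determined by the other four. *)
rewrite big_spairs; apply: (big_bij
  (fun t => (t.2.1.1.2, t.2.2.1.2, t.2.1.1.1, t.2.2.1.1))
  (fun q : F * F * F * F => let: (psi1, psi2, phi1, phi2) := q in
     let k := ((phi1, psi1), chi `\` psi1 `\` psi2)%mset in
     let l := ((phi2, psi2), phi `\` phi1 `\` phi2)%mset in
     ((gm k, gp l), (k, l)))).
- apply: spairs_uniq; first exact: decomp_uniq.
  by move=> t; apply: spairs_uniq => *; exact: fib_uniq.
- exact: fset_uniq.
- move=> [[k' l'] [[[phi1 psi1] xi] [[phi2 psi2] zeta]]].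
  rewrite !mem_spairs mem_decomp !mem_fib /= => /and3P[/eqP kl /eqP k /eqP l].
  have [phiE chiE] : phi1 + zeta + phi2 = phi /\ psi1 + xi + psi2 = chi.
    by move: kl; rewrite -k -l => -[<- <-]; rewrite !addr0 addrAC addrA.
  have xiE : (chi `\` psi1 `\` psi2)%mset = xi by rewrite -chiE msetBB.
  have zetaE : (phi `\` phi1 `\` phi2)%mset = zeta by rewrite -phiE msetBB.
  rewrite xiE zetaE -k -l; split => //.
    rewrite in_fset_set ?inE /=; last exact: finite_submsets4.
    by split; apply/msubsetP => c; rewrite -?chiE -?phiE !msetE2; lia.
  rewrite -GE /D_series /= exprD.
  rewrite -!mulrA; congr (_ * _); rewrite !mulrA; congr (_ * _).
  exact/commr_sign.
- move=> [[[psi1 psi2] phi1] phi2].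
  rewrite in_fset_set ?inE; last exact: finite_submsets4.
  case=> chi_ge phi_ge; split; last by [].
  rewrite !mem_spairs mem_decomp !mem_fib !eqxx !andbT.
  apply/eqP; congr (_, _); rewrite /= !addr0.
    by rewrite addrA addrAC msetBBK.
  exact: msetBBK.
Qed.
End MultisetSeries.

End GarlandFormula.

Theorem lemma5p4 (R : realType) (A : comAlgType R[i]) (phi chi : {mset A}) :
  xprod xp phi * xprod xm chi =
  \sum_(q \in [set q : {mset A} * {mset A} * {mset A} * {mset A} |
                 let: (psi1, psi2, phi1, phi2) := q in
                 submsets chi (psi1 `+` psi2)%mset /\
                 submsets phi (phi1 `+` phi2)%mset])
    let: (psi1, psi2, phi1, phi2) :=
      q : {mset A} * {mset A} * {mset A} * {mset A} in
    (-1) ^+ (size psi1 + size psi2) *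
    D xm phi1 psi1 (chi `\` psi1 `\` psi2)%mset *
    bbD phi2 psi2 (phi `\` phi1 `\` phi2)%mset.
Proof. exact: GarlandFormula.garland_formula. Qed.
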